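(* For every $\delta\in(0,1)$ there is a randomized set difference estimator (a data structure implicitly maintaining two sets $S_1,S_2$, each of size at most $n$, and supporting the operations update, merge and query) that uses $O(\log(1/\delta)\log n)$ space, supports update, merge and query each in $O(\log(1/\delta))$ time, and whose query reports $|S_1\oplus S_2|$ to within a constant factor with probability at least $1-\delta$.
   Context: Computation is in the word RAM model with word size $w=\Omega(\log u+\log n)$, where $u$ is the size of the universe the elements come from. A set difference estimator implicitly maintains two sets $S_1$ and $S_2$ and supports: update, which takes an element $x$ and an index $i\in\{1,2\}$ and adds $x$ to $S_i$; merge, which takes a second set difference estimator (built with the same randomness) implicitly maintaining $S_1',S_2'$ and returns a set difference estimator representing $S_1\cup S_1'$ and $S_2\cup S_2'$; and query, which returns an estimate of $|S_1\oplus S_2|$, the size of the symmetric difference.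
   Formalization: Update is required only for x not already in S_i, and merge only when S_i and S_i' are disjoint for i = 1, 2; with repeated insertions or overlapping unions the claim is false, since it would solve the INDEX problem on n bits in polylogarithmic space. *)

(* Defs.v *)
From HB Require Import structures.
From mathcomp Require Import all_boot all_order all_algebra.
From mathcomp Require Import reals exp.

Set Implicit Arguments.
Unset Strict Implicit.
Unset Printing Implicit Defensive.

Import Order.TTheory GRing.Theory Num.Theory.

(* ------------------------- The word RAM ------------------------------- *)

(* A word is a natural number below 2 ^ w. [MulHi] is the high word of the
   double-length product. *)
Inductive binop : Type :=
  | Add | Sub | Mul | MulHi | Div | Mod
  | And | Or | Xor | Shl | Shr | Eqw | Ltw.

Definition eval_binop (w : nat) (o : binop) (x y : nat) : nat :=
  (match o with
   | Add => x + y
   | Sub => x + 2 ^ w - y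
   | Mul => x * y
   | MulHi => (x * y) %/ 2 ^ w
   | Div => x %/ y
   | Mod => x %% y
   | And => Nat.land x y
   | Or => Nat.lor x y
   | Xor => Nat.lxor x y
   | Shl => x * 2 ^ y
   | Shr => x %/ 2 ^ y
   | Eqw => x == y
   | Ltw => x < y
   end) %% 2 ^ w.

(* Programs use word registers and, separately, index registers. Index
   registers only address memory and count iterations: they can be moved by one
   cell or by a word, and compared, but never stored in memory. They hold
   unbounded naturals because nothing relates the number of memory cells
   to w: log (1 / delta) may exceed 2 ^ w, and w may be a small
   constant multiple of log u + log n.
   Memory is a family of arrays. The shared random words form a read-only
   array, accessed by [CRand]. *)
Inductive cmd : Type :=
  | CSkip
  | CSet (r v : nat)               (* word r := v *)
  | COp (o : binop) (r a b : nat)  (* word r := word a o word b *)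
  | CISet (i v : nat)              (* index i := v *)
  | CIMov (i j : nat)              (* index i := index j *)
  | CIInc (i : nat)
  | CIDec (i : nat)
  | CIAdd (i a : nat)              (* index i := index i + word a *)
  | CILt (r i j : nat)             (* word r := index i < index j *)
  | CLoad (r A i : nat)            (* word r := array A at index i *)
  | CStore (A i r : nat)           (* array A at index i := word r *)
  | CRand (r i : nat)              (* word r := random word at index i *)
  | CSeq (p q : cmd)
  | CIf (r : nat) (p q : cmd)
  | CWhile (r : nat) (p : cmd).

Record state : Type := State {
  wreg : nat -> nat;
  ireg : nat -> nat;
  arr : nat -> nat -> nat
}.

Definition put (T : Type) (f : nat -> T) (k : nat) (v : T) : nat -> T :=
  fun j => if j == k then v else f j.

Definition set_wreg (w : nat) (s : state) (r v : nat) : state :=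
  State (put (wreg s) r (v %% 2 ^ w)) (ireg s) (arr s).

Definition set_ireg (s : state) (i v : nat) : state :=
  State (wreg s) (put (ireg s) i v) (arr s).

Definition set_mem (s : state) (A i v : nat) : state :=
  State (wreg s) (ireg s) (put (arr s) A (put (arr s A) i v)).

(* [exec w rnd p s t s']: on word size w and random words rnd, program p
   takes state s to state s' in exactly t steps. *)
Inductive exec (w : nat) (rnd : nat -> nat) :
    cmd -> state -> nat -> state -> Prop :=
  | ExecSkip s : exec w rnd CSkip s 1 s
  | ExecSet r v s : exec w rnd (CSet r v) s 1 (set_wreg w s r v)
  | ExecOp o r a b s :
      exec w rnd (COp o r a b) s 1
        (set_wreg w s r (eval_binop w o (wreg s a) (wreg s b)))
  | ExecISet i v s : exec w rnd (CISet i v) s 1 (set_ireg s i v)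
  | ExecIMov i j s : exec w rnd (CIMov i j) s 1 (set_ireg s i (ireg s j))
  | ExecIInc i s : exec w rnd (CIInc i) s 1 (set_ireg s i (ireg s i).+1)
  | ExecIDec i s : exec w rnd (CIDec i) s 1 (set_ireg s i (ireg s i).-1)
  | ExecIAdd i a s :
      exec w rnd (CIAdd i a) s 1 (set_ireg s i (ireg s i + wreg s a))
  | ExecILt r i j s :
      exec w rnd (CILt r i j) s 1 (set_wreg w s r (ireg s i < ireg s j))
  | ExecLoad r A i s :
      exec w rnd (CLoad r A i) s 1 (set_wreg w s r (arr s A (ireg s i)))
  | ExecStore A i r s :
      exec w rnd (CStore A i r) s 1 (set_mem s A (ireg s i) (wreg s r))
  | ExecRand r i s :
      exec w rnd (CRand r i) s 1 (set_wreg w s r (rnd (ireg s i)))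
  | ExecSeq p q s s1 s2 t1 t2 :
      exec w rnd p s t1 s1 -> exec w rnd q s1 t2 s2 ->
      exec w rnd (CSeq p q) s (t1 + t2) s2
  | ExecIfTrue r p q s s' t :
      wreg s r != 0 -> exec w rnd p s t s' ->
      exec w rnd (CIf r p q) s t.+1 s'
  | ExecIfFalse r p q s s' t :
      wreg s r = 0 -> exec w rnd q s t s' ->
      exec w rnd (CIf r p q) s t.+1 s'
  | ExecWhileTrue r p s s1 s2 t1 t2 :
      wreg s r != 0 -> exec w rnd p s t1 s1 ->
      exec w rnd (CWhile r p) s1 t2 s2 ->
      exec w rnd (CWhile r p) s (t1 + t2).+1 s2
  | ExecWhileFalse r p s :
      wreg s r = 0 -> exec w rnd (CWhile r p) s 1 s.

(* The number x laid out in consecutive words, least significant first; as a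
   bit string, x is thereby packed w bits to the word. *)
Definition words (w x : nat) : nat -> nat := fun i => (x %/ 2 ^ (w * i)) %% 2 ^ w.

(* ------------------ Histories of set difference estimators ------------ *)

(* Sides: [false] is S_1 and [true] is S_2. *)
Inductive history (u : nat) : Type :=
  | Empty
  | Update (h : history u) (i : bool) (x : 'I_u)
  | Merge (h1 h2 : history u).
Arguments Empty {u}.

Fixpoint maintained (u : nat) (h : history u) (i : bool) : {set 'I_u} :=
  match h with
  | Empty => set0
  | Update h' j x =>
      if i == j then x |: maintained h' i else maintained h' i
  | Merge h1 h2 => maintained h1 i :|: maintained h2 i
  end.

Definition symdiff (T : finType) (A B : {set T}) : {set T} :=
  (A :\: B) :|: (B :\: A).

Definition difference (u : nat) (h : history u) : nat :=
  #|symdiff (maintained h false) (maintained h true)|.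

(* An element is inserted into a given side at most once, so all unions are
   disjoint. With overlapping unions no small sketch exists: from a sketch of
   (A, set0), inserting all of V but y into both sides (V containing A) would
   leave a symmetric difference of size 1 or 0 according to whether y is in A. *)
Fixpoint no_reinsertion (u : nat) (h : history u) : bool :=
  match h with
  | Empty => true
  | Update h' i x => no_reinsertion h' && (x \notin maintained h' i)
  | Merge h1 h2 =>
      [&& no_reinsertion h1, no_reinsertion h2
        & [forall i : bool, [disjoint maintained h1 i & maintained h2 i]]]
  end.

Definition legal (u n : nat) (h : history u) : bool :=
  no_reinsertion h && [forall i : bool, #|maintained h i| <= n].

(* ------------------ Set difference estimators ------------------------- *)

(* The random words are uniform, fixed once, and shared by all estimators that
   are to be merged; they are not part of the sketch. The sketch, all that an
   estimator itself stores, is a string of [sketch_bits] bits. The three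
   functions are the input-output behaviour of the operations.
   [wparam] and [iparam] are precomputed constants found in the initial
   registers; a program mentions finitely many registers, so uses O(1) of them. *)
Record estimator (u w : nat) : Type := Estimator {
  rand_words : nat;
  sketch_bits : nat;
  wparam : seq nat;
  iparam : seq nat;
  sketch0 : 'I_(2 ^ sketch_bits);
  update : rand_words.-tuple 'I_(2 ^ w) ->
    'I_(2 ^ sketch_bits) -> bool -> 'I_u -> 'I_(2 ^ sketch_bits);
  merge : rand_words.-tuple 'I_(2 ^ w) ->
    'I_(2 ^ sketch_bits) -> 'I_(2 ^ sketch_bits) -> 'I_(2 ^ sketch_bits);
  query : rand_words.-tuple 'I_(2 ^ w) -> 'I_(2 ^ sketch_bits) -> nat
}.

Definition coins (u w : nat) (E : estimator u w) : finType :=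
  ((rand_words E).-tuple 'I_(2 ^ w))%type.

Definition sketch (u w : nat) (E : estimator u w) : finType :=
  'I_(2 ^ sketch_bits E).

Fixpoint sketch_of (u w : nat) (E : estimator u w) (rho : coins E)
    (h : history u) : sketch E :=
  match h with
  | Empty => sketch0 E
  | Update h' i x => update rho (sketch_of rho h') i x
  | Merge h1 h2 => merge rho (sketch_of rho h1) (sketch_of rho h2)
  end.

Definition estimate (u w : nat) (E : estimator u w) (rho : coins E)
  (h : history u) : nat := query rho (sketch_of rho h).

(* Arrays through which the operations receive inputs and return results. *)
Definition SKETCH : nat := 0.
Definition ARG : nat := 1.
Definition SIDE : nat := 2.
Definition OUT : nat := 3.

(* Arrays not given as inputs are zero. *)
Definition start (u w : nat) (E : estimator u w) (m : nat -> nat -> nat) : state :=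
  State (fun r => nth 0 (wparam E) r %% 2 ^ w) (nth 0 (iparam E)) m.

Definition no_mem : nat -> nat -> nat := fun _ _ => 0.

(* From the input arrays m, program p leaves the number y in array A within
   T steps. *)
Definition computes (u w : nat) (E : estimator u w) (R : realType)
    (rho : coins E) (p : cmd) (m : nat -> nat -> nat) (A y : nat) (T : R) : Prop :=
  exists t s',
    [/\ exec w (nth 0 [seq nat_of_ord z | z <- rho]) p (start E m) t s',
        arr s' A =1 words w y
      & (t%:R <= T)%R].

(* Every operation that leads to a legal history is carried out by its program
   in at most T steps, whatever the random words. *)
Definition update_time (u w n : nat) (E : estimator u w) (R : realType)
    (p : cmd) (T : R) : Prop :=
  forall (rho : coins E) (h : history u) (i : bool) (x : 'I_u),
    legal n (Update h i x) ->
    computes rho p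
      (put (put (put no_mem SKETCH (words w (sketch_of rho h)))
                ARG (words w x))
           SIDE (words w i))
      SKETCH (sketch_of rho (Update h i x)) T.

Definition merge_time (u w n : nat) (E : estimator u w) (R : realType)
    (p : cmd) (T : R) : Prop :=
  forall (rho : coins E) (h1 h2 : history u),
    legal n (Merge h1 h2) ->
    computes rho p
      (put (put no_mem SKETCH (words w (sketch_of rho h1)))
           ARG (words w (sketch_of rho h2)))
      SKETCH (sketch_of rho (Merge h1 h2)) T.

Definition query_time (u w n : nat) (E : estimator u w) (R : realType)
    (p : cmd) (T : R) : Prop :=
  forall (rho : coins E) (h : history u),
    legal n h ->
    computes rho p (put no_mem SKETCH (words w (sketch_of rho h)))
      OUT (estimate rho h) T.

Definition Pr (R : realType) (T : finType) (B : pred T) : R :=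
  (#|[set x | B x]|%:R / #|T|%:R)%R.

Definition within_factor (K d e : nat) : bool := (d <= K * e) && (e <= K * d).

Definition accurate (u w n : nat) (E : estimator u w) (R : realType)
    (K : nat) (delta : R) : Prop :=
  forall h : history u, legal n h ->
    (1 - delta <=
       Pr R (fun rho : coins E => within_factor K (difference h) (estimate rho h)))%R.

(* Factors in asymptotic bounds: 1 + log x, so that O(.) is meaningful also
   where the logarithm vanishes (n = 1, delta close to 1). *)
Definition lg1 (R : realType) (x : R) : R := (1 + ln x)%R.

(* Main.v *)
Require Import Defs.
From HB Require Import structures.
From mathcomp Require Import all_boot all_order all_algebra.
From mathcomp Require Import reals exp.
From mathcomp Require Import zify ring lra.
From Stdlib Require PeanoNat.

(* Hash every element x to a vector F(x) of O(log n) bits, at most one of them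
   set, level j with probability B^-(j+1), pairwise independently: AND together
   s one-hot words 2^(LV-1) / lowbit(h_i(x)), with B = 2^s. A copy of the sketch
   is the XOR of F(x) over all insertions, so elements of both sets cancel and
   merging is XOR. With d = |S_1 (+) S_2| and B^j <= 2d < B^(j+1), a copy has bit
   j set with constant probability (exactly one element is sampled), and bits
   beyond level j + 1 are rare. The OR of a constant number of copies thus has
   deepest level j or j + 1 with probability at least 63/64; among O(log(1/delta))
   such groups over two thirds do so with probability at least 1 - delta. A
   two-candidate majority vote in linear time then finds one of these two levels,
   i.e. B^j up to a factor B.
   The constant s is chosen after c so that all levels fit in half a word; when
   words are too short even for this, w <= 3 and u is bounded by a constant, and
   the sketch is the exact bitmap of S_1 (+) S_2. *)

Set Implicit Arguments.
Unset Strict Implicit.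
Unset Printing Implicit Defensive.

(** * Bits of natural numbers *)

(** The obstacle is a word of only [c] times (log u + log n) bits with [c] possibly small: an
    element may fill several words, and log n levels of ratio 2 need not fit in one. The single
    parameter [s] answers both: an element is read as [s] words, and ANDing [s] hashes raises the
    level ratio to [2 ^ s], which divides the number of levels by about [s]. Fields of at most half
    a word also serve the hash, which multiplies half-word digits by random words and keeps the top
    bits: digit length plus kept bits must not exceed the word. Within a copy pairwise independence
    suffices, since only first and second moments are used. Copies and groups read disjoint random
    words, so their probabilities multiply exactly and are treated as cardinalities. Level j + 1 may
    be set with any probability, so neither acceptable level need win a majority of the groups;
    hence two candidates and a two-thirds threshold. Programs are fixed before u, n, w and delta:
    repetitions governed by [s] alone are unrolled, those governed by delta are loops. *)

Definition bit (n i : nat) : bool := odd (n %/ 2 ^ i).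

Lemma testbitE n i : Nat.testbit n i = bit n i.
Proof.
elim: i n => [|i IH] n.
  rewrite /bit expn0 divn1 /=.
  elim/ltn_ind: n => -[|[|n]] // IH.
  by rewrite /= negbK -IH //=.
have -> : Nat.testbit n i.+1 = Nat.testbit (Nat.div2 n) i by [].
have -> : Nat.div2 n = n %/ 2.
  elim/ltn_ind: n => -[|[|n]] // h; rewrite /= h //; lia.
by rewrite IH /bit expnS divnMA.
Qed.

Lemma bit_inj a b : bit a =1 bit b -> a = b.
Proof.
by move=> ab; apply: PeanoNat.Nat.bits_inj => i; rewrite !testbitE.
Qed.

Lemma bit_lxor a b i : bit (Nat.lxor a b) i = bit a i (+) bit b i.
Proof. by rewrite -!testbitE PeanoNat.Nat.lxor_spec; do 2!case: Nat.testbit. Qed.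

Lemma bit_land a b i : bit (Nat.land a b) i = bit a i && bit b i.
Proof. by rewrite -!testbitE PeanoNat.Nat.land_spec. Qed.

Lemma bit_lor a b i : bit (Nat.lor a b) i = bit a i || bit b i.
Proof. by rewrite -!testbitE PeanoNat.Nat.lor_spec. Qed.

Definition bitE := (bit_lxor, bit_land, bit_lor).

Lemma bit0n i : bit 0 i = false.
Proof. by rewrite /bit div0n. Qed.

Lemma bit_div a k i : bit (a %/ 2 ^ k) i = bit a (k + i).
Proof. by rewrite /bit -divnMA expnD. Qed.

Lemma bit_mod a k i : bit (a %% 2 ^ k) i = (i < k) && bit a i.
Proof.
rewrite /bit; case: (ltnP i k) => [ik|ki] /=; last first.
  rewrite divn_small //; apply: leq_trans (ltn_pmod _ _) _; first by rewrite expn_gt0.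
  by rewrite leq_exp2l.
have E : 2 ^ k = 2 ^ (k - i.+1) * 2 * 2 ^ i.
  by rewrite -expnSr -expnD; congr (2 ^ _); lia.
rewrite [in RHS](divn_eq a (2 ^ k)) [X in _ * X + _]E mulnA divnMDl ?expn_gt0 //.
by rewrite oddD !oddM !andbF.
Qed.

Lemma bit_mul a k i : bit (a * 2 ^ k) i = (k <= i) && bit a (i - k).
Proof.
case: (leqP k i) => [ki|ik] /=.
  by rewrite /bit -{1}(subnKC ki) expnD divnMA mulnK ?expn_gt0.
rewrite -[bit _ _]andTb -{1}ik -bit_mod modnMl; exact: bit0n.
Qed.

Lemma bit_small a k i : a < 2 ^ k -> k <= i -> bit a i = false.
Proof. by move=> /modn_small <- ki; rewrite bit_mod ltnNge ki. Qed.

Lemma bit_pow t i : bit (2 ^ t) i = (i == t).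
Proof.
rewrite -[2 ^ t]mul1n bit_mul; case: ltngtP => //= [ti|->]; last by rewrite subnn.
by rewrite (@bit_small 1 1) // subn_gt0.
Qed.

Lemma lt_of_bits a k : (forall i, k <= i -> bit a i = false) -> a < 2 ^ k.
Proof.
move=> h; suff -> : a = a %% 2 ^ k by rewrite ltn_pmod // expn_gt0.
apply: bit_inj => i; rewrite bit_mod; case: (ltnP i k) => // /h ->.
by [].
Qed.

Lemma lxor_lt a b k : a < 2 ^ k -> b < 2 ^ k -> Nat.lxor a b < 2 ^ k.
Proof.
by move=> ak bk; apply: lt_of_bits => i ki; rewrite bitE !(bit_small _ ki).
Qed.

Lemma lor_lt a b k : a < 2 ^ k -> b < 2 ^ k -> Nat.lor a b < 2 ^ k.
Proof.
by move=> ak bk; apply: lt_of_bits => i ki; rewrite bitE !(bit_small _ ki).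
Qed.

Lemma land_lt a b k : b < 2 ^ k -> Nat.land a b < 2 ^ k.
Proof.
by move=> bk; apply: lt_of_bits => i ki; rewrite bitE (bit_small bk ki) andbF.
Qed.

Lemma nat_bit_eq0 a : (forall i, bit a i = false) -> a = 0.
Proof. by move=> h; apply: bit_inj => i; rewrite h bit0n. Qed.

Lemma lxorA : associative Nat.lxor.
Proof. by move=> a b c; apply: bit_inj => i; rewrite !bitE addbA. Qed.
Lemma lxorC : commutative Nat.lxor.
Proof. by move=> a b; apply: bit_inj => i; rewrite !bitE addbC. Qed.
Lemma lxor0n : left_id 0 Nat.lxor.
Proof. by move=> a; apply: bit_inj => i; rewrite !bitE bit0n. Qed.
HB.instance Definition _ := Monoid.isComLaw.Build nat 0 Nat.lxor lxorA lxorC lxor0n.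

Lemma bit_wordsE w y a b : bit (words w y a) b = (b < w) && bit y (w * a + b).
Proof. by rewrite /words bit_mod bit_div. Qed.

Lemma words_lxor w a b i :
  words w (Nat.lxor a b) i = Nat.lxor (words w a i) (words w b i).
Proof.
apply: bit_inj => j; rewrite !(bitE, bit_wordsE).
by case: (j < w).
Qed.

Lemma words_lt w y i : words w y i < 2 ^ w.
Proof. by rewrite ltn_pmod // expn_gt0. Qed.

Lemma words0 w i : words w 0 i = 0.
Proof. by rewrite /words div0n mod0n. Qed.

Lemma words_shift w v a i : v < 2 ^ w ->
  words w (v * 2 ^ (w * a)) i = if i == a then v else 0.
Proof.
move=> vw; apply: bit_inj => j; rewrite bit_wordsE bit_mul.
case: eqP => [->|ia].
  rewrite leq_addr addKn; case: ltnP => //= wj; by rewrite (bit_small vw wj).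
rewrite bit0n; case: ltnP => //= jw; case: leqP => //= h.
by apply: (bit_small vw); nia.
Qed.

Lemma words_big w y i B : y < 2 ^ B -> B <= w * i -> words w y i = 0.
Proof.
move=> yB Bi; rewrite /words divn_small ?mod0n //.
by apply: leq_trans yB _; rewrite leq_exp2l.
Qed.

(** The machine idiom [-v & v] in two's complement on [w] bits: it isolates the lowest set bit and
    is 0 at [v = 0]. *)
Definition lowbit (w v : nat) : nat := Nat.land ((2 ^ w - v) %% 2 ^ w) v.

Lemma land_compl n m : m < 2 ^ n -> Nat.land (2 ^ n - 1 - m) m = 0.
Proof.
elim: n m => [|n IH] m mn; first by rewrite expn0 ltnS leqn0 in mn; rewrite (eqP mn).
have hm : m = odd m + (m %/ 2) * 2 ^ 1 by lia.
have m2 : m %/ 2 < 2 ^ n by rewrite ltn_divLR // -expnSr.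
set c := 2 ^ n.+1 - 1 - m.
have hc : c = ~~ odd m + (2 ^ n - 1 - m %/ 2) * 2 ^ 1.
  by rewrite /c expnS; lia.
apply: nat_bit_eq0 => -[|i].
  rewrite bitE /bit expn0 !divn1 hc [in X in _ && X]hm !oddD expn1 !oddM !andbF !addbF.
  by case: (odd m).
have hi x : bit x i.+1 = bit (x %/ 2) i by rewrite -(bit_div x 1 i) expn1.
rewrite bitE !hi.
have -> : c %/ 2 = 2 ^ n - 1 - m %/ 2 by rewrite hc; lia.
by rewrite -bitE IH // bit0n.
Qed.

Lemma lowbit0 w : lowbit w 0 = 0.
Proof. by rewrite /lowbit subn0 modnn. Qed.

(** The hypothesis says that [v] has exactly [t] trailing zeros. Negation modulo [2 ^ w] keeps bit
    [t] and complements all bits above it, so the AND retains bit [t] alone. *)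
Lemma lowbit_lev w v t : v < 2 ^ w -> v %% 2 ^ t.+1 = 2 ^ t -> lowbit w v = 2 ^ t.
Proof.
move=> vw vt; have t0 : 0 < 2 ^ t by rewrite expn_gt0.
have v0 : 0 < v by case: v vt {vw} => //; rewrite mod0n; lia.
have tw : t < w.
  rewrite ltnNge; apply/negP => wt; move: vt; rewrite modn_small; last first.
    by apply: leq_trans vw _; rewrite leq_exp2l //; lia.
  move=> vE; move: vw; rewrite vE ltn_exp2l //; lia.
rewrite /lowbit modn_small; last by lia.
set m := v %/ 2 ^ t.+1.
have vE : v = m * 2 ^ t.+1 + 2 ^ t by rewrite -vt -divn_eq.
set n := w - t.+1.
have wE : 2 ^ w = 2 ^ n * 2 ^ t.+1 by rewrite -expnD subnK.
have mn : m < 2 ^ n by rewrite ltn_divLR ?expn_gt0 // -wE.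
have cE : 2 ^ w - v = (2 ^ n - 1 - m) * 2 ^ t.+1 + 2 ^ t.
  rewrite vE wE; move: mn; rewrite expnS; nia.
(* The two summands share no bit, so their sum is an XOR and can be read bit by bit. *)
have key x i : bit (x * 2 ^ t.+1 + 2 ^ t) i = (i == t) || (t < i) && bit x (i - t.+1).
  have p1 : x * 2 ^ t.+1 + 2 ^ t = Nat.lxor (x * 2 ^ t.+1) (2 ^ t).
    rewrite -PeanoNat.Nat.add_nocarry_lxor //.
    apply: nat_bit_eq0 => k; rewrite bitE bit_mul bit_pow.
    by case: eqP => [->|_]; rewrite ?ltnn ?andbF.
  by rewrite p1 bitE bit_mul bit_pow; case: eqP => [->|]; rewrite ?ltnn ?addbF.
apply: bit_inj => i; rewrite cE [in X in Nat.land _ X]vE bitE !key bit_pow.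
case: eqP => //= _; case: ltnP => //= _.
by rewrite -bitE land_compl // bit0n.
Qed.

(** * Pairwise uniform hashing *)

(** Halving the words keeps every difference of digits below [D], so that its multiples reach all
    multiples of [D] modulo [2 ^ w]. *)
Definition digit (D : nat) (X : nat -> nat) (j : nat) : nat :=
  if odd j then X j./2 %/ D else X j./2 %% D.

Definition digit_sum (D : nat) (r X : nat -> nat) (n : nat) : nat :=
  r 0 + \sum_(j < n.*2) digit D X j * r j.+1.

(** The multiply-shift scheme for vectors: the top bits of a random affine form modulo [2 ^ w], with
    [r 0] as the additive term. *)
Definition hash (w D : nat) (r X : nat -> nat) (n : nat) : nat :=
  (digit_sum D r X n %% 2 ^ w) %/ D.

Definition rnd (N w : nat) (rho : N.-tuple 'I_(2 ^ w)) : nat -> nat :=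
  nth 0 [seq nat_of_ord z | z <- rho].

Lemma rndE N w (rho : N.-tuple 'I_(2 ^ w)) (i : 'I_N) : rnd rho i = tnth rho i.
Proof.
rewrite /rnd (nth_map (tnth rho i)) ?size_tuple; last exact: ltn_ord.
by rewrite -tnth_nth.
Qed.

Lemma modn_eq_add M A B a b : A + M * a = B + M * b -> A = B %[mod M].
Proof.
by move=> h; rewrite -(modnMDl a A) -(modnMDl b B) ![_ * M]mulnC addnC h addnC.
Qed.

(* The hash takes all values equally often because adding a fixed vector to
   the random words translates it: this finds the vector for a given pair of
   translations. *)
Lemma bezout_shift w h e t : 0 < e < 2 ^ h -> h <= w ->
  exists a, a * e = 2 ^ h * t %[mod 2 ^ w].
Proof.
case/andP=> e0 eh hw.
have [a aM] := Bezoutr e (expn_gt0 2 w : 0 < 2 ^ w).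
case/dvdnP=> k; set g := gcdn _ _ => E.
have [v vw gv] : exists2 v, v <= w & g = 2 ^ v.
  by apply/(dvdn_pfactor _ _ (isT : prime 2)); rewrite dvdn_gcdr.
(* The gcd divides [e < 2 ^ h], so this power of two divides [2 ^ h]; here the bound on the digits
   enters. *)
have vh : v <= h.
  by rewrite -(@leq_exp2l 2) // -gv; apply: leq_trans (ltnW eh); rewrite dvdn_leq // dvdn_gcdl.
(* [Bezoutr] gives [a * e = - g] modulo [2 ^ w]; the factor [2 ^ w - 1] acts as -1, and
   [2 ^ (h - v) * t] scales [g] to [2 ^ h * t]. *)
exists ((2 ^ w - 1) * a * 2 ^ (h - v) * t).
have hE : 2 ^ h = g * 2 ^ (h - v) by rewrite gv -expnD subnKC.
have M0 : 0 < 2 ^ w by rewrite expn_gt0.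
set G := 2 ^ (h - v) in hE *.
have ME : 2 ^ w = (2 ^ w - 1) + 1 by rewrite subnK.
set M' := 2 ^ w - 1 in ME *.
apply: (@modn_eq_add _ _ _ (G * t * g) (M' * G * t * k)).
rewrite hE.
transitivity ((g + a * e) * (M' * G * t) + G * t * g); first by rewrite ME; ring.
by rewrite E; ring.
Qed.

Lemma digit_neq D X Y n : (exists2 k, k < n & X k != Y k) ->
  exists2 j, j < n.*2 & digit D X j != digit D Y j.
Proof.
case=> k kn XY; case: (eqVneq (X k %% D) (Y k %% D)) => [m|m]; last first.
  exists k.*2; first by rewrite ltn_double.
  by rewrite /digit odd_double doubleK.
exists k.*2.+1; first by rewrite -doubleS leq_double.
rewrite /digit /= odd_double /= uphalf_double.
apply: contra XY => /eqP q.
by rewrite (divn_eq (X k) D) q m -divn_eq.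
Qed.

Lemma digit_lt w h X j : (forall k, X k < 2 ^ w) -> w <= h.*2 ->
  digit (2 ^ h) X j < 2 ^ h.
Proof.
move=> Xw wh; rewrite /digit; case: odd; last by rewrite ltn_pmod ?expn_gt0.
rewrite ltn_divLR ?expn_gt0 // -expnD addnn.
by apply: leq_trans (Xw _) _; rewrite leq_exp2l.
Qed.

Section Translation.
Variables (N w : nat) (tau : nat -> nat).

Definition translate (rho : N.-tuple 'I_(2 ^ w)) : N.-tuple 'I_(2 ^ w) :=
  [tuple Ordinal (ltn_pmod (tnth rho i + tau i) (expn_gt0 2 w)) | i < N].

Lemma rnd_translate rho i : i < N ->
  rnd (translate rho) i = (rnd rho i + tau i) %% 2 ^ w.
Proof. by move=> iN; rewrite !(rndE _ (Ordinal iN)) tnth_mktuple. Qed.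

Lemma translate_inj : injective translate.
Proof.
move=> r1 r2 E; apply: eq_from_tnth => i; apply: val_inj.
have := congr1 (fun r => val (tnth r i)) E; rewrite !tnth_mktuple /= => /eqP.
rewrite eqn_modDr => /eqP; rewrite !modn_small //; exact: ltn_ord.
Qed.

End Translation.

Lemma digit_sum_translate n D w tau (rho : n.*2.+1.-tuple 'I_(2 ^ w)) X :
  digit_sum D (rnd (translate tau rho)) X n =
  digit_sum D (rnd rho) X n + digit_sum D tau X n %[mod 2 ^ w].
Proof.
rewrite /digit_sum addnACA -big_split /=.
rewrite -modnDm -[in RHS]modnDm; congr ((_ + _) %% _).
  by rewrite rnd_translate // modn_mod.
rewrite -modn_summ -[in RHS]modn_summ; congr (_ %% _); apply: eq_bigr => j _.
rewrite rnd_translate; last by rewrite ltnS ltn_ord.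
by rewrite modnMmr mulnDr.
Qed.

(** Shifting the sum by a multiple of [2 ^ h] leaves its low [h] bits alone, so no carry reaches the
    kept bits and the hash is rotated by exactly [t]. *)
Lemma hash_translate n h w tau (rho : n.*2.+1.-tuple 'I_(2 ^ w)) X t :
  h <= w -> digit_sum (2 ^ h) tau X n = 2 ^ h * t %[mod 2 ^ w] ->
  hash w (2 ^ h) (rnd (translate tau rho)) X n =
  (hash w (2 ^ h) (rnd rho) X n + t) %% 2 ^ (w - h).
Proof.
move=> hw Ht; rewrite /hash digit_sum_translate -modnDmr Ht modnDmr -modnDml.
set S := digit_sum _ _ _ _ %% _; set D := 2 ^ h; set L := 2 ^ (w - h).
have -> : 2 ^ w = L * D by rewrite -expnD subnK.
have D0 : 0 < D by rewrite expn_gt0.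
rewrite -modn_divl; congr (_ %% _).
by rewrite addnC mulnC divnMDl // addnC.
Qed.

Lemma digit_sum_single D a b j X n : j < n.*2 ->
  digit_sum D (fun i => if i == 0 then b else if i == j.+1 then a else 0) X n =
  b + digit D X j * a.
Proof.
move=> jn; rewrite /digit_sum /= (bigD1 (Ordinal jn)) //= eqxx big1 ?addn0 //.
by move=> i ij; rewrite ifN ?muln0.
Qed.

Lemma translation_to n h w X t :
  exists tau, digit_sum (2 ^ h) tau X n = 2 ^ h * t %[mod 2 ^ w].
Proof.
exists (fun i => if i == 0 then 2 ^ h * t else 0).
by rewrite /digit_sum /= big1 ?addn0 // => i _; rewrite muln0.
Qed.

(** Only the additive word [b] and one multiplier [a], at a digit where [X] and [Y] differ, are
    moved. The difference of the two equations determines [a], and the second then determines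
    [b]. *)
Lemma translation_to2 n h w X Y t1 t2 : h <= w <= h.*2 ->
  (forall k, X k < 2 ^ w) -> (forall k, Y k < 2 ^ w) ->
  (exists2 k, k < n & X k != Y k) ->
  exists tau, digit_sum (2 ^ h) tau X n = 2 ^ h * t1 %[mod 2 ^ w] /\
              digit_sum (2 ^ h) tau Y n = 2 ^ h * t2 %[mod 2 ^ w].
Proof.
case/andP=> hw wh Xw Yw /(digit_neq (2 ^ h))[j jn].
wlog XY : X Y t1 t2 Xw Yw / digit (2 ^ h) Y j < digit (2 ^ h) X j => [W|_].
  rewrite neq_ltn => /orP[] lt; last by apply: W; rewrite // neq_ltn lt orbT.
  by have [|tau [? ?]] := W Y X t2 t1 Yw Xw lt; [rewrite neq_ltn lt orbT|exists tau].
have [a aE] : exists a, a * (digit (2 ^ h) X j - digit (2 ^ h) Y j) =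
    2 ^ h * (t1 + (2 ^ w - 1) * t2) %[mod 2 ^ w].
  apply: bezout_shift hw.
  by rewrite subn_gt0 XY /= (leq_ltn_trans (leq_subr _ _)) // (digit_lt j Xw wh).
set dx := digit _ X j in aE XY *; set dy := digit _ Y j in aE XY *.
(* [M1] is -1 modulo [2 ^ w]; truncated subtraction on [nat] is thus avoided. *)
set M1 := 2 ^ w - 1 in aE.
have ME : 2 ^ w = M1 + 1 by rewrite subnK ?expn_gt0.
pose b := 2 ^ h * t2 + M1 * (dy * a).
exists (fun i => if i == 0 then b else if i == j.+1 then a else 0).
rewrite !digit_sum_single // -/dx -/dy; split; last first.
  by apply: (@modn_eq_add _ _ _ 0 (dy * a)); rewrite ME /b; ring.
have -> : b + dx * a = b + dy * a + a * (dx - dy) by rewrite mulnBr; nia.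
rewrite -modnDmr aE modnDmr.
apply: (@modn_eq_add _ _ _ 0 (2 ^ h * t2 + dy * a)); rewrite ME /b; ring.
Qed.

(* A map into a type on which translations of the domain act transitively is
   equidistributed. *)
Lemma card_preim_equi (T V : finType) (f : T -> V) (A : {set V}) :
  (forall a b, exists2 g : T -> T, injective g &
     forall x, f x = a -> f (g x) = b) ->
  #|f @^-1: A| * #|V| = #|A| * #|T|.
Proof.
move=> H.
have le a b : #|f @^-1: [set a]| <= #|f @^-1: [set b]|.
  have [g gi gE] := H a b; rewrite -(card_imset _ gi); apply: subset_leq_card.
  by apply/subsetP => y /imsetP[x]; rewrite !inE => /eqP xa ->; apply/eqP/gE.
have eq a b : #|f @^-1: [set a]| = #|f @^-1: [set b]|.
  by apply/eqP; rewrite eqn_leq !le.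
have card_sum (B : {set V}) : #|f @^-1: B| = \sum_(b in B) #|f @^-1: [set b]|.
  rewrite -sum1_card (partition_big f (mem B)) => [|x] /=; last by rewrite inE.
  apply: eq_bigr => b bB; rewrite -sum1_card; apply: eq_bigl => x.
  by rewrite !inE; case: eqP => [->|]; rewrite ?bB ?andbF.
case: (set_0Vmem A) => [->|[a aA]]; first by rewrite preimset0 !cards0.
have -> : #|T| = #|f @^-1: [set: V]| by rewrite preimsetT cardsT.
rewrite !card_sum (eq_bigr (fun=> #|f @^-1: [set a]|)) => [|b _]; last exact: eq.
rewrite [in RHS](eq_bigr (fun=> #|f @^-1: [set a]|)) => [|b _]; last exact: eq.
by rewrite !sum_nat_const cardsT mulnAC mulnA.
Qed.

Section HashUniform.
Variables (n h w : nat) (X Y : nat -> nat).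
Hypotheses (hw : h <= w) (wh : w <= h.*2).
Hypotheses (Xw : forall k, X k < 2 ^ w) (Yw : forall k, Y k < 2 ^ w).

Lemma hash_lt r Z : hash w (2 ^ h) r Z n < 2 ^ (w - h).
Proof. by rewrite ltn_divLR ?expn_gt0 // -expnD subnK // ltn_pmod ?expn_gt0. Qed.

Definition hash_ord (Z : nat -> nat) (rho : n.*2.+1.-tuple 'I_(2 ^ w)) :
  'I_(2 ^ (w - h)) := Ordinal (hash_lt (rnd rho) Z).

Lemma rotate_mod (a b : 'I_(2 ^ (w - h))) : (a + (b + (2 ^ (w - h) - a))) %% 2 ^ (w - h) = b.
Proof.
by rewrite addnCA subnKC ?(ltnW (ltn_ord a)) // modnDr modn_small.
Qed.

Lemma card_hash (A : {set 'I_(2 ^ (w - h))}) :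
  #|[set rho | hash_ord X rho \in A]| * 2 ^ (w - h) =
  #|A| * #|{: n.*2.+1.-tuple 'I_(2 ^ w)}|.
Proof.
rewrite -[X in _ * X = _]card_ord; apply: card_preim_equi => a b.
have [tau E] := translation_to n h w X (b + (2 ^ (w - h) - a)).
exists (translate tau); first exact: translate_inj.
move=> rho /(congr1 val) /= aE; apply: val_inj.
by rewrite /= (hash_translate _ hw E) aE rotate_mod.
Qed.

(** Some translation of the random words carries any given pair of hash values to any other, so the
    pair is uniform on the square. *)
Lemma card_hash2 (A : {set 'I_(2 ^ (w - h))}) :
  (exists2 k, k < n & X k != Y k) ->
  #|[set rho | (hash_ord X rho \in A) && (hash_ord Y rho \in A)]| * (2 ^ (w - h)) ^ 2 =
  #|A| ^ 2 * #|{: n.*2.+1.-tuple 'I_(2 ^ w)}|.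
Proof.
move=> XY; have := @card_preim_equi _ _
  (fun rho => (hash_ord X rho, hash_ord Y rho)) (setX A A).
rewrite cardsX card_prod !card_ord !mulnn => <-.
  by congr (#|pred_of_set _| * _); apply/setP => rho; rewrite !inE.
move=> [a1 a2] [b1 b2].
have [|tau [E1 E2]] := @translation_to2 n h w X Y (b1 + (2 ^ (w - h) - a1))
  (b2 + (2 ^ (w - h) - a2)) _ Xw Yw XY; first by rewrite hw.
exists (translate tau); first exact: translate_inj.
move=> rho [/(congr1 val) /= aE1 /(congr1 val) /= aE2]; congr pair; apply: val_inj.
  by rewrite /= (hash_translate _ hw E1) aE1 rotate_mod.
by rewrite /= (hash_translate _ hw E2) aE2 rotate_mod.
Qed.

End HashUniform.

Definition level_is (v j : nat) : bool := v %% 2 ^ j.+1 == 2 ^ j.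

Lemma card_level L j : j < L -> #|[set v : 'I_(2 ^ L) | level_is v j]| * 2 ^ j.+1 = 2 ^ L.
Proof.
move=> jL.
have lt (m : 'I_(2 ^ (L - j.+1))) : m * 2 ^ j.+1 + 2 ^ j < 2 ^ L.
  rewrite -[in X in _ < X](subnK jL) expnD; have := ltn_ord m.
  by have : 2 ^ j < 2 ^ j.+1; [rewrite ltn_exp2l|nia].
have -> : [set v : 'I_(2 ^ L) | level_is v j] = [set Ordinal (lt m) | m in [set: 'I_(2 ^ (L - j.+1))]].
  apply/setP => v; rewrite inE; apply/eqP/imsetP => [vE|[m _ ->]]; last first.
    by rewrite /= modnMDl modn_small // ltn_exp2l.
  have vl : v %/ 2 ^ j.+1 < 2 ^ (L - j.+1).
    by rewrite ltn_divLR ?expn_gt0 // -expnD subnK.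
  by exists (Ordinal vl) => //; apply: val_inj; rewrite /= -vE -divn_eq.
rewrite card_imset ?cardsT ?card_ord -?expnD ?subnK // => a b /(congr1 val) /= /eqP.
by rewrite eqn_add2r eqn_mul2r expn_eq0 /= => /eqP /val_inj.
Qed.

(** * Blocks of random words and level sampling *)

Section Blocks.
Variables (a b w : nat).
Notation big := ((a * b).-tuple 'I_(2 ^ w)).
Notation small := (b.-tuple 'I_(2 ^ w)).

Lemma block_index (g : 'I_a) (i : 'I_b) : g * b + i < a * b.
Proof.
by case: g i => g ga [i ib] /=; apply: (@leq_trans (g.+1 * b)); [rewrite mulSn; lia|rewrite leq_mul2r ga orbT].
Qed.

Definition block (rho : big) (g : 'I_a) : small :=
  [tuple tnth rho (Ordinal (block_index g i)) | i < b].

Lemma rnd_block rho (g : 'I_a) i : i < b -> rnd (block rho g) i = rnd rho (g * b + i).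
Proof.
move=> ib; rewrite (rndE _ (Ordinal ib)) tnth_mktuple.
exact: (esym (rndE rho (Ordinal (block_index g (Ordinal ib))))).
Qed.

Lemma blocks_bij : bijective (fun rho : big => [ffun g => block rho g]).
Proof.
apply: inj_card_bij; last first.
  by rewrite card_ffun !card_tuple (card_ord a) -expnM mulnC leqnn.
move=> r1 r2 E; apply: eq_from_tnth => k; apply: val_inj.
have /andP[_ b0] : (0 < a) && (0 < b) by rewrite -muln_gt0 (leq_ltn_trans _ (ltn_ord k)).
have ga : k %/ b < a by rewrite ltn_divLR.
have ib : k %% b < b by rewrite ltn_pmod.
have /ffunP /(_ (Ordinal ga)) := E; rewrite !ffunE => Eb.
have := rnd_block r1 (Ordinal ga) ib; rewrite Eb rnd_block //= -divn_eq.
by rewrite !rndE.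
Qed.

(** Independence of the blocks in counting form: up to normalisation, the expectation of a product
    is the product of expectations. *)
Lemma sum_blocks (phi : 'I_a -> small -> nat) :
  \sum_(rho : big) \prod_(g < a) phi g (block rho g) = \prod_(g < a) \sum_(c : small) phi g c.
Proof.
rewrite bigA_distr_bigA (reindex _ (onW_bij _ blocks_bij)) /=.
by apply: eq_bigr => rho _; apply: eq_bigr => g _; rewrite ffunE.
Qed.

Lemma card_blocks (A : 'I_a -> {set small}) :
  #|[set rho : big | [forall g, block rho g \in A g]]| = \prod_(g < a) #|A g|.
Proof.
under [RHS]eq_bigr => g _ do rewrite -sum1_card big_mkcond /=.
rewrite -sum_blocks -sum1_card big_mkcond /=; apply: eq_bigr => rho _.
rewrite inE; case: forallP => [h|h].
  by rewrite big1 // => g _; rewrite h.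
have [g hg] : exists g, block rho g \notin A g.
  by apply/existsP; rewrite -negb_forall; apply/negP => /forallP.
by rewrite (bigD1 g) //= (negbTE hg) mul0n.
Qed.

Lemma card_all_blocks (A : {set small}) :
  #|[set rho : big | [forall g, block rho g \in A]]| = #|A| ^ a.
Proof. by rewrite (card_blocks (fun=> A)) prod_nat_const card_ord. Qed.

Lemma card_some_block (A : {set small}) :
  #|[set rho : big | [exists g, block rho g \in A]]| * #|{: small}| <= a * #|A| * #|{: big}|.
Proof.
have one g0 : #|[set rho : big | block rho g0 \in A]| * #|{: small}| = #|A| * #|{: big}|.
  have -> : #|[set rho : big | block rho g0 \in A]| =
            #|[set rho : big | [forall g, block rho g \in if g == g0 then A else setT]]|.
    apply: eq_card => rho; rewrite !inE; apply/idP/forallP => [h g|/(_ g0)]; last by rewrite eqxx.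
    by case: eqP => [->|] //; rewrite inE.
  rewrite (card_blocks (fun g => if g == g0 then A else setT)) (bigD1 g0) //= eqxx.
  rewrite (eq_bigr (fun=> #|{: small}|)) => [|g /negbTE ->]; last by rewrite cardsT.
  rewrite -mulnA; congr (_ * _).
  have -> : #|{: big}| = #|{: small}| ^ a by rewrite !card_tuple -expnM mulnC.
  have -> : #|{: small}| ^ a = \prod_(g < a) #|{: small}| by rewrite prod_nat_const card_ord.
  by rewrite [in RHS](bigD1 g0) //= mulnC.
have : #|[set rho : big | [exists g, block rho g \in A]]| <= \sum_(g < a) #|[set rho : big | block rho g \in A]|.
  have -> : [set rho : big | [exists g, block rho g \in A]] = \bigcup_(g < a) [set rho : big | block rho g \in A].
    apply/setP => rho; rewrite inE; apply/existsP/bigcupP => [[g hg]|[g _]].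
      by exists g; rewrite ?inE.
    by rewrite inE => hg; exists g.
  apply: (big_ind2 (fun (X : {set big}) n => #|X| <= n)); rewrite ?cards0 //.
  by move=> X1 n1 X2 n2 h1 h2; apply: leq_trans (leq_card_setU _ _) (leq_add h1 h2).
move=> /(leq_mul (leqnn #|{: small}|)); rewrite mulnC => /leq_trans; apply.
rewrite mulnC big_distrl /= (eq_bigr (fun=> #|A| * #|{: big}|)) => [|g _]; last exact: one.
by rewrite sum_nat_const card_ord mulnA.
Qed.

End Blocks.

Lemma bit_ones L i : i < L -> bit (2 ^ L - 1) i.
Proof.
move=> iL; have -> : 2 ^ L - 1 = (2 ^ (L - i) - 1) * 2 ^ i + (2 ^ i - 1).
  have -> : 2 ^ L = 2 ^ (L - i) * 2 ^ i by rewrite -expnD; congr (2 ^ _); lia.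
  have : 0 < 2 ^ (L - i) by rewrite expn_gt0.
  by have : 0 < 2 ^ i; [rewrite expn_gt0|nia].
rewrite /bit divnMDl ?expn_gt0 // divn_small; last by rewrite subn1 prednK ?expn_gt0.
by rewrite addn0 oddB ?expn_gt0 // oddX /= subn_eq0 leqNgt iL.
Qed.

(** * Level sampling by ANDing one-hot words *)

Section Model.
Variables (w LV s : nat).
Hypotheses (LV0 : 0 < LV) (LVw : LV.*2 <= w).

Definition hash_width := s.*2.+1.

(* A hash value with j trailing zeros gives the word with only bit LV - 1 - j
   set, so that deeper levels are lower bits and lowbit finds the deepest one.
   Hash value 0 gives the zero word because x %/ 0 = 0. *)
Definition onehot (r X : nat -> nat) : nat :=
  2 ^ LV.-1 %/ lowbit w (hash w (2 ^ (w - LV)) r X s).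

Fixpoint fval (r X : nat -> nat) (n : nat) : nat :=
  if n is n'.+1 then Nat.land (fval r X n') (onehot (fun i => r (n' * hash_width + i)) X)
  else 2 ^ LV - 1.

Lemma hash_ext r1 r2 X : (forall i, i < hash_width -> r1 i = r2 i) ->
  hash w (2 ^ (w - LV)) r1 X s = hash w (2 ^ (w - LV)) r2 X s.
Proof.
move=> E; rewrite /hash /digit_sum E //; congr ((_ + _) %% _ %/ _).
by apply: eq_bigr => j _; rewrite E // ltnS ltn_ord.
Qed.

Lemma fval_ext r1 r2 X n : (forall i, i < n * hash_width -> r1 i = r2 i) ->
  fval r1 X n = fval r2 X n.
Proof.
elim: n => //= n IH E; rewrite IH => [|i iL]; last by apply: E; rewrite mulSn; lia.
congr (Nat.land _ (_ %/ lowbit _ _)); apply: hash_ext => i iQ.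
by apply: E; rewrite mulSn; lia.
Qed.

Lemma level_uniq L v i j : v < 2 ^ L -> level_is v i -> level_is v j -> i = j.
Proof.
move=> vL /eqP /(lowbit_lev vL) Ei /eqP /(lowbit_lev vL); rewrite Ei => /eqP.
by rewrite eqn_exp2l // => /eqP.
Qed.

Lemma level_ex v : 0 < v -> exists t, level_is v t.
Proof.
move=> v0; have [m o vE] := pfactor_coprime (isT : prime 2) v0.
exists (logn 2 v); rewrite /level_is; set t := logn 2 v in vE *.
rewrite coprime2n in o; rewrite vE expnS -muln_modl modn2 o mul1n //.
Qed.

Lemma bit_onehot r X j : j < LV ->
  bit (onehot r X) (LV.-1 - j) = level_is (hash w (2 ^ (w - LV)) r X s) j.
Proof.
move=> jL; rewrite /onehot; set v := hash _ _ _ _ _.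
have vL : v < 2 ^ LV.
  have -> : LV = w - (w - LV) by lia.
  by apply: hash_lt; lia.
have vw : v < 2 ^ w by apply: leq_trans vL _; rewrite leq_exp2l //; lia.
case: (posnP v) => [->|v0].
  by rewrite lowbit0 divn0 bit0n /level_is mod0n eq_sym expn_eq0.
have [t vt] := level_ex v0.
have tL : t < LV.
  rewrite ltnNge; apply/negP => Lt; move: vt; rewrite /level_is modn_small.
    by move/eqP=> E; move: vL; rewrite E ltn_exp2l //; lia.
  by apply: leq_trans vL _; rewrite leq_exp2l //; lia.
rewrite (lowbit_lev vw (eqP vt)).
have -> : 2 ^ LV.-1 = 2 ^ (LV.-1 - t) * 2 ^ t by rewrite -expnD; congr (2 ^ _); lia.
rewrite mulnK ?expn_gt0 // bit_pow.
apply/eqP/idP => [E|vj]; last by rewrite (level_uniq vL vt vj).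
by have -> : j = t by lia.
Qed.

Lemma bit_fval r X n j : j < LV -> bit (fval r X n) (LV.-1 - j) =
  [forall t : 'I_n, level_is (hash w (2 ^ (w - LV)) (fun i => r (t * hash_width + i)) X s) j].
Proof.
move=> jL; elim: n => [|n IH] /=.
  have -> : [forall t : 'I_0, level_is (hash w (2 ^ (w - LV)) (fun i => r (t * hash_width + i)) X s) j].
    by apply/forallP => -[].
  by rewrite bit_ones //; lia.
rewrite bitE IH bit_onehot //; apply/andP/forallP => [[/forallP h1 h2] t|h].
  case: (unliftP ord_max t) => [t' ->|->]; last exact: h2.
  by have := h1 t'; rewrite lift_max.
split; last exact: (h ord_max).
by apply/forallP => t; have := h (widen_ord (leqnSn n) t).
Qed.

Lemma fval_lt r X n : fval r X n < 2 ^ LV.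
Proof.
elim: n => /= [|n IH]; first by rewrite subn1 prednK ?expn_gt0.
apply: lt_of_bits => i iL; rewrite bitE (bit_small IH iL) //.
Qed.

End Model.

(** * One copy of the sketch *)

(** Used to sum the sampling probabilities of all levels from a given one on, which decay
    geometrically. *)
Lemma sum_halving n (h : nat -> nat) :
  (forall i, i.+1 < n -> 2 * h i.+1 <= h i) -> \sum_(i < n) h i <= 2 * h 0.
Proof.
elim: n h => [|n IH] h H; first by rewrite big_ord0.
rewrite big_ord_recl; under eq_bigr => i _ do rewrite lift0.
case: n IH H => [|n] IH H; first by rewrite big_ord0 /=; lia.
have := IH (fun i => h i.+1) (fun i iL => H i.+1 iL); have := H 0 isT.
by rewrite /=; lia.
Qed.

(** That is, [(1 - 1 / r) ^ r <= 1 / 2]: two terms of the binomial expansion of [((r - 1) + 1) ^ r]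
    already amount to [2 * (r - 1) ^ r]. It turns a miss probability [1 - 1 / r] into 1/2 over [r]
    copies. *)
Lemma expn_pred_half r : 0 < r -> 2 * (r - 1) ^ r <= r ^ r.
Proof.
case: r => // r _; rewrite subn1 /=.
have B k : r ^ k.+1 + k.+1 * r ^ k <= r.+1 ^ k.+1.
  elim: k => [|k IH]; first by rewrite !expn1 expn0; lia.
  rewrite (expnS r.+1) (expnS r k.+1); apply: leq_trans (leq_mul (leqnn r.+1) IH).
  by rewrite (expnS r k); set a := r ^ k; nia.
apply: leq_trans (B r); rewrite expnS; lia.
Qed.

Lemma words_neq u w s (x y : 'I_u) : 0 < w -> u <= 2 ^ (w * s) -> x != y -> exists2 k, k < s & words w x k != words w y k.
Proof.
move=> w0 us xy.
have [|/hasPn H] := boolP (has (fun k => words w x k != words w y k) (iota 0 s)).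
  by case/hasP => k; rewrite mem_iota => /andP[_ ks] ?; exists k.
case/eqP: xy; apply: val_inj; apply: bit_inj => i.
case: (ltnP i (w * s)) => is_; last first.
  by rewrite !(@bit_small _ (w * s)) //; apply: leq_trans (ltn_ord _) us.
have : i %/ w < s by rewrite ltn_divLR // mulnC.
have -> : (i %/ w < s) = (i %/ w \in iota 0 s) by rewrite mem_iota.
move=> /H; rewrite negbK => /eqP E.
have := bit_wordsE w x (i %/ w) (i %% w); rewrite E bit_wordsE ltn_pmod //= => /esym.
by rewrite mulnC -divn_eq.
Qed.

Section Copy.
Variables (u w LV s : nat).
Hypotheses (LV0 : 0 < LV) (LVw : LV.*2 <= w) (us : u <= 2 ^ (w * s)) (s0 : 0 < s).

Notation T1 := ((hash_width s).-tuple 'I_(2 ^ w)).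
Notation T2 := ((s * hash_width s).-tuple 'I_(2 ^ w)).

Definition hit (X : nat -> nat) (j : nat) : {set T2} :=
  [set c | bit (fval w LV s (rnd c) X s) (LV.-1 - j)].

Definition level_set (X : nat -> nat) (j : nat) : {set T1} :=
  [set c | level_is (hash w (2 ^ (w - LV)) (rnd c) X s) j].

Lemma hitE X j c : j < LV -> (c \in hit X j) = [forall t, block c t \in level_set X j].
Proof.
move=> jL; rewrite inE bit_fval //; apply: eq_forallb => t; rewrite inE.
by congr level_is; apply: hash_ext => i iQ; rewrite rnd_block.
Qed.

Lemma card_level_set X j : j < LV -> (forall k, X k < 2 ^ w) ->
  #|level_set X j| * 2 ^ j.+1 = #|{: T1}|.
Proof.
move=> jL Xw; have hw : w - LV <= w by exact: leq_subr.
have := @card_hash s (w - LV) w X hw [set v : 'I_(2 ^ (w - (w - LV))) | level_is v j].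
have -> : [set rho | hash_ord hw X rho \in [set v : 'I_(2 ^ (w - (w - LV))) | level_is v j]] = level_set X j.
  by apply/setP => c; rewrite !inE.
have jL' : j < w - (w - LV) by lia.
have := card_level jL'; set a := #|_|; set L := 2 ^ (w - _) => aL E.
have L0 : 0 < L by rewrite expn_gt0.
apply/eqP; rewrite -(eqn_pmul2r L0) mulnAC E -aL; apply/eqP; ring.
Qed.

Lemma card_level_set2 X Y j : j < LV ->
  (forall k, X k < 2 ^ w) -> (forall k, Y k < 2 ^ w) -> (exists2 k, k < s & X k != Y k) ->
  #|level_set X j :&: level_set Y j| * (2 ^ j.+1) ^ 2 = #|{: T1}|.
Proof.
move=> jL Xw Yw XY; have hw : w - LV <= w by exact: leq_subr.
have wh : w <= (w - LV).*2 by lia.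
have := @card_hash2 s (w - LV) w X Y hw wh Xw Yw [set v : 'I_(2 ^ (w - (w - LV))) | level_is v j] XY.
have -> : [set rho | (hash_ord hw X rho \in [set v : 'I_(2 ^ (w - (w - LV))) | level_is v j]) &&
    (hash_ord hw Y rho \in [set v : 'I_(2 ^ (w - (w - LV))) | level_is v j])] = level_set X j :&: level_set Y j.
  by apply/setP => c; rewrite !inE.
have jL' : j < w - (w - LV) by lia.
have := card_level jL'; set a := #|_|; set L := 2 ^ (w - _) => aL E.
have L0 : 0 < L ^ 2 by rewrite expn_gt0 expn_gt0.
apply/eqP; rewrite -(eqn_pmul2r L0) mulnAC E -aL; apply/eqP; ring.
Qed.

Lemma card_T2 : #|{: T2}| = #|{: T1}| ^ s.
Proof. by rewrite !card_tuple -expnM mulnC. Qed.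

Lemma card_hit X j : j < LV -> (forall k, X k < 2 ^ w) ->
  #|hit X j| * 2 ^ (s * j.+1) = #|{: T2}|.
Proof.
move=> jL Xw.
have -> : hit X j = [set c | [forall t, block c t \in level_set X j]].
  by apply/setP => c; rewrite hitE // inE.
by rewrite card_all_blocks mulnC [s * _]mulnC expnM -expnMn mulnC card_level_set // card_T2.
Qed.

Lemma card_hit2 X Y j : j < LV ->
  (forall k, X k < 2 ^ w) -> (forall k, Y k < 2 ^ w) -> (exists2 k, k < s & X k != Y k) ->
  #|hit X j :&: hit Y j| * (2 ^ (s * j.+1)) ^ 2 = #|{: T2}|.
Proof.
move=> jL Xw Yw XY.
have -> : hit X j :&: hit Y j = [set c | [forall t, block c t \in level_set X j :&: level_set Y j]].
  apply/setP => c; rewrite inE !hitE // inE; apply/andP/forallP.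
    by case=> /forallP h1 /forallP h2 t; rewrite inE h1 h2.
  by move=> h; split; apply/forallP => t; have := h t; rewrite inE => /andP[].
rewrite card_all_blocks [s * _]mulnC expnM -expnM mulnC [s * 2]mulnC expnM -expnMn mulnC.
by rewrite card_level_set2 // card_T2.
Qed.

Variable Delta : {set 'I_u}.
Notation d := (#|Delta|).

Definition copy_sketch (r : nat -> nat) : nat :=
  \big[Nat.lxor/0]_(x in Delta) fval w LV s r (words w x) s.

Definition hits (j : nat) (c : T2) : nat := \sum_(x in Delta) (c \in hit (words w x) j).

Lemma bit_big_lxor (I : finType) (A : {set I}) (F : I -> nat) i :
  bit (\big[Nat.lxor/0]_(x in A) F x) i = odd (\sum_(x in A) bit (F x) i).
Proof.
apply: (big_ind2 (fun a n => bit a i = odd n)); first by rewrite bit0n.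
  by move=> a n b m ha hb; rewrite bitE ha hb oddD.
by move=> x _; rewrite oddb.
Qed.

Lemma bit_copy_sketch j c : bit (copy_sketch (rnd c)) (LV.-1 - j) = odd (hits j c).
Proof.
rewrite bit_big_lxor; congr odd; apply: eq_bigr => x _.
by rewrite inE.
Qed.

Lemma sum_hits j : \sum_c hits j c = \sum_(x in Delta) #|hit (words w x) j|.
Proof.
rewrite exchange_big /=; apply: eq_bigr => x _.
by rewrite -sum1_card [RHS]big_mkcond /=; apply: eq_bigr => c _; case: (c \in _).
Qed.

(** An indicator equals its square, so the diagonal reduces to the first moment; what remains are
    pairs of distinct elements, to which pairwise uniformity applies. *)
Lemma sum_hits_sq j : \sum_c hits j c ^ 2 =
  \sum_(x in Delta) #|hit (words w x) j| +
  \sum_(x in Delta) \sum_(y in Delta | y != x) #|hit (words w x) j :&: hit (words w y) j|.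
Proof.
rewrite -big_split /=.
transitivity (\sum_c \sum_(x in Delta) \sum_(y in Delta)
   (c \in hit (words w x) j :&: hit (words w y) j : nat)).
  apply: eq_bigr => c _; rewrite -mulnn [in LHS]/hits big_distrl /=; apply: eq_bigr => x _.
  by rewrite big_distrr /=; apply: eq_bigr => y _; rewrite in_setI mulnb.
rewrite exchange_big; apply: eq_bigr => x xD /=; rewrite exchange_big /=.
have cardE (A : {set T2}) : \sum_c (c \in A : nat) = #|A|.
  by rewrite -sum1_card [RHS]big_mkcond /=; apply: eq_bigr => c _; case: (c \in _).
rewrite (bigD1 x) //= cardE setIid; congr (_ + _).
by apply: eq_bigr => y _; rewrite cardE.
Qed.

(* With d/E in [1/(2B), 1/2) exactly one element of Delta is sampled with
   probability at least d/E - (d/E)^2. *)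
Lemma card_odd_hits j : j < LV -> 2 * d < 2 ^ (s * j.+1) <= 2 * d * 2 ^ s ->
  #|{: T2}| <= #|[set c | odd (hits j c)]| * (4 * 2 ^ s).
Proof.
move=> jL /andP[]; set E := 2 ^ _; set B := 2 ^ s => dE Ed.
set O := #|_|; set N := #|{: T2}|.
(* For every natural [k], [2 * k <= odd k + k ^ 2]; hence two moments bound the chance of odd parity
   from below. *)
have key : 2 * \sum_c hits j c <= O + \sum_c hits j c ^ 2.
  have -> : O = \sum_c (odd (hits j c) : nat).
    rewrite /O -sum1_card [LHS]big_mkcond /=; apply: eq_bigr => c _.
    by rewrite inE; case: odd.
  rewrite big_distrr -big_split /=; apply: leq_sum => c _.
  by case: (hits j c) => [|[|k]] //=; rewrite expnS expn1; nia.
rewrite sum_hits_sq sum_hits in key.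
have {key} key : \sum_(x in Delta) #|hit (words w x) j| <=
   O + \sum_(x in Delta) \sum_(y in Delta | y != x) #|hit (words w x) j :&: hit (words w y) j|.
  by lia.
have S1 : (\sum_(x in Delta) #|hit (words w x) j|) * E = d * N.
  rewrite big_distrl /= (eq_bigr (fun=> N)) => [|x _]; first by rewrite sum_nat_const.
  by rewrite card_hit //; exact: words_lt.
have S2 : (\sum_(x in Delta) \sum_(y in Delta | y != x) #|hit (words w x) j :&: hit (words w y) j|) * E ^ 2 <= d ^ 2 * N.
  rewrite big_distrl /=; apply: (@leq_trans (\sum_(x in Delta) d * N)); last by rewrite sum_nat_const mulnA mulnn.
  apply: leq_sum => x _; rewrite big_distrl /=.
  rewrite (eq_bigr (fun=> N)) => [|y /andP[_ xy]]; last first.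
    rewrite card_hit2 //; try exact: words_lt.
    by apply: words_neq; rewrite 1?eq_sym //; lia.
  rewrite sum_nat_const leq_mul2r; apply/orP; right; apply: subset_leq_card.
  by apply/subsetP => y; rewrite unfold_in => /andP[].
move: key S1 S2; set S := \sum_(x in _) _; set S' := \sum_(x in _) _ => key S1 S2.
have E0 : 0 < E by rewrite expn_gt0.
have k2 : d * N * E <= O * E ^ 2 + d ^ 2 * N.
  apply: leq_trans (leq_add (leqnn _) S2); rewrite -S1 -mulnDl -mulnA mulnn.
  by rewrite leq_mul2r key orbT.
have k3 : N * (d * (E - d)) <= O * E ^ 2 by rewrite mulnBr mulnBr leq_subLR; nia.
(* From [d >= E / (2 * B)] and [E - d >= E / 2]; this is the origin of the factor [4 * 2 ^ s]. *)
have k4 : E ^ 2 <= (4 * B) * (d * (E - d)).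
  have h1 : E <= 2 * (E - d) by lia.
  have := leq_mul Ed h1; rewrite mulnn; nia.
have E20 : 0 < E ^ 2 by rewrite expn_gt0 E0.
rewrite -(leq_pmul2r E20); apply: leq_trans (leq_mul (leqnn N) k4) _; nia.
Qed.

(** Any sampled element counts, whatever the parity. This only enlarges the event that the copy has
    a set bit at level [j] or deeper, and it allows a union bound. *)
Definition deep (j : nat) : {set T2} :=
  [set c | [exists x in Delta, [exists i : 'I_LV, (j <= i) && (c \in hit (words w x) i)]]].

(** Union bound over elements and levels; each further level is at most half as likely, so the
    levels together cost twice the first one. *)
Lemma card_deep j : #|deep j| * 2 ^ (s * j.+1) <= 2 * d * #|{: T2}|.
Proof.
set N := #|{: T2}|.
pose hx (x : 'I_u) i := #|hit (words w x) (j + i)|.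
have le1 : #|deep j| <= \sum_(x in Delta) \sum_(i < LV - j) hx x i.
  have -> : deep j = \bigcup_(x in Delta) \bigcup_(i < LV - j) hit (words w x) (j + i).
    apply/setP => c; rewrite inE; apply/existsP/bigcupP.
      case=> x /andP[xD /existsP[i /andP[ji ci]]]; exists x => //; apply/bigcupP.
      have iL : i - j < LV - j by have := ltn_ord i; lia.
      by exists (Ordinal iL) => //=; rewrite subnKC.
    case=> x xD /bigcupP[i _ ci]; exists x; rewrite xD /=; apply/existsP.
    have iL : j + i < LV by have := ltn_ord i; lia.
    by exists (Ordinal iL); rewrite leq_addr.
  apply: (big_ind2 (fun (X : {set T2}) n => #|X| <= n)); rewrite ?cards0 //.
    by move=> X1 n1 X2 n2 h1 h2; apply: leq_trans (leq_card_setU _ _) (leq_add h1 h2).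
  move=> x _; apply: (big_ind2 (fun (X : {set T2}) n => #|X| <= n)); rewrite ?cards0 //.
  by move=> X1 n1 X2 n2 h1 h2; apply: leq_trans (leq_card_setU _ _) (leq_add h1 h2).
case: (ltnP j LV) => jL; last first.
  suff -> : #|deep j| = 0 by [].
  apply/eqP; rewrite -leqn0; apply: leq_trans le1 _; rewrite big1 // => x _.
  by rewrite (eqP jL) big_ord0.
apply: leq_trans (leq_mul le1 (leqnn _)) _.
rewrite big_distrl /=; apply: (@leq_trans (\sum_(x in Delta) 2 * N)); last by rewrite sum_nat_const mulnCA mulnA.
apply: leq_sum => x _.
have hN i : j + i < LV -> hx x i * 2 ^ (s * (j + i).+1) = N.
  by move=> iL; rewrite card_hit // => k; exact: words_lt.
apply: (@leq_trans (2 * hx x 0 * 2 ^ (s * j.+1))).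
  rewrite leq_mul2r; apply/orP; right; apply: sum_halving => i iL.
  have h1 : j + i < LV by lia.
  have h2 : j + i.+1 < LV by lia.
  have := hN _ h1; have := hN _ h2; rewrite addnS [s * _.+2]mulnS expnD => E2 E1.
  have E0 : 0 < 2 ^ (s * (j + i).+1) by rewrite expn_gt0.
  rewrite -(leq_pmul2r E0) E1 -E2.
  have : 2 ^ 1 <= 2 ^ s by rewrite leq_exp2l.
  by nia.
by rewrite -mulnA; have := hN 0; rewrite addn0 => ->.
Qed.

End Copy.

(** * Voting among groups of copies *)

Fixpoint lor_upto (f : nat -> nat) (n : nat) : nat :=
  if n is n'.+1 then Nat.lor (lor_upto f n') (f n') else 0.

Lemma bit_lor_upto f n i : bit (lor_upto f n) i = has (fun k => bit (f k) i) (iota 0 n).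
Proof.
elim: n => [|n IH]; first by rewrite /= bit0n.
by rewrite [lor_upto _ _]/= bitE IH -[in RHS](addn1 n) iotaD has_cat /= orbF.
Qed.

Lemma lor_upto_lt f n L : (forall k, f k < 2 ^ L) -> lor_upto f n < 2 ^ L.
Proof. by move=> h; elim: n => [|n IH] /=; rewrite ?expn_gt0 // lor_lt. Qed.

Lemma eq_lor_upto f g n : (forall k, k < n -> f k = g k) -> lor_upto f n = lor_upto g n.
Proof.
elim: n => //= n IH h; rewrite h // IH // => k kn; apply: h; exact: ltnW.
Qed.

Lemma level_of_bits v t : bit v t -> (forall i, i < t -> bit v i = false) -> v %% 2 ^ t.+1 = 2 ^ t.
Proof.
move=> vt lo; apply: bit_inj => i; rewrite bit_mod bit_pow ltnS.
by case: ltngtP => [/lo|//|->].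
Qed.

(* Two candidates with counters, as in the Misra-Gries heavy hitters algorithm. *)
Record tally2 := Tally2 { cand1 : nat; cand2 : nat; cnt1 : nat; cnt2 : nat }.

Definition vote (t : tally2) (y : nat) : tally2 :=
  let: Tally2 c1 c2 n1 n2 := t in
  if y == c1 then Tally2 c1 c2 n1.+1 n2
  else if y == c2 then Tally2 c1 c2 n1 n2.+1
  else if n1 == 0 then Tally2 y c2 1 n2
  else if n2 == 0 then Tally2 c1 y n1 1
  else Tally2 c1 c2 n1.-1 n2.-1.

Fixpoint election (f : nat -> nat) (n : nat) : tally2 :=
  if n is n'.+1 then vote (election f n') (f n') else Tally2 0 0 0 0.

Definition winner (t : tally2) : nat :=
  if cnt1 t < cnt2 t then cand2 t else cand1 t.

(* A round in which both counters decrease cancels three distinct values, one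
   of which is bad. Hence #good <= goodcounts + 2 (#bad - badcounts). *)
Lemma winner_good (f : nat -> nat) n (good : pred nat) a b :
  (forall y, good y -> y = a \/ y = b) ->
  3 * (\sum_(k < n) ~~ good (f k)) < n -> good (winner (election f n)).
Proof.
move=> ab.
pose wt (t : tally2) p := p (cand1 t) * cnt1 t + p (cand2 t) * cnt2 t.
pose gd y : nat := good y; pose bd y : nat := ~~ good y.
have gb y : gd y + bd y = 1 by rewrite /gd /bd; case: (good _).
have three x y z : x <> y -> x <> z -> y <> z -> gd x + gd y + gd z <= 2.
  rewrite /gd; case g0: (good x); case g1: (good y); case g2: (good z) => //.
  by case: (ab _ g0) (ab _ g1) (ab _ g2) => -> [] -> [] ->.
(* The first clause ensures that a cancelling round involves three distinct values: once the second
   counter is positive, the candidates differ, although both start as 0. *)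
have inv : let t := election f n in let s := \sum_(k < n) bd (f k) in
  [/\ 0 < cnt2 t -> cand1 t != cand2 t, wt t bd <= s &
      (\sum_(k < n) gd (f k)) + 2 * wt t bd <= wt t gd + 2 * s].
  clearbody gd bd; elim: n => [|n]; first by rewrite /= !big_ord0 /wt /= !muln0.
  rewrite /= !big_ord_recr /=; move: (election f n) => [c1 c2 n1 n2] /=.
  rewrite /wt /= => -[i1 i2 i3].
  move: (\sum_(k < n) _) (\sum_(k < n) _) i2 i3 => S1 S2 i2 i3.
  case: (f n =P c1) i1 i2 i3 => [<-|yc1] i1 i2 i3 /=; first by split=> //; have := gb (f n); nia.
  case: (f n =P c2) i1 i2 i3 => [<-|yc2] i1 i2 i3 /=.
    by split; [move=> _; apply/eqP => E; apply: yc1|have := gb (f n); nia..].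
  case: eqP => [n10|n1p] /=.
    by split; [move=> _; apply/eqP; exact: yc2|have := gb (f n); rewrite n10 in i2 i3 *; nia..].
  case: eqP => [n20|n2p] /=.
    by split; [move=> _; apply/eqP => E; apply: yc1|have := gb (f n); rewrite n20 in i2 i3 *; nia..].
  have c12 : c1 != c2 by apply: i1; lia.
  have tr := three _ _ _ yc1 yc2 (fun E => negP c12 (introT eqP E)).
  have := gb (f n); have := gb c1; have := gb c2.
  split=> //; first by nia.
  have [k1 E1] : exists k, n1 = k.+1 by exists n1.-1; lia.
  have [k2 E2] : exists k, n2 = k.+1 by exists n2.-1; lia.
  rewrite E1 E2 !mulnS in i2 i3 *; lia.
case: inv => _; move: (election f n) => [c1 c2 n1 n2]; rewrite /wt /winner /=.
have gbs : \sum_(k < n) gd (f k) + \sum_(k < n) bd (f k) = n.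
  rewrite -big_split /= (eq_bigr (fun=> 1)) ?sum_nat_const ?card_ord ?muln1 //.
rewrite -[\sum_(k < n) ~~ _]/(\sum_(k < n) bd (f k)).
move: (\sum_(k < n) gd _) (\sum_(k < n) bd _) gbs => S1 S2.
rewrite /gd /bd => gbs h1 h2 h3.
(* With fewer than [n / 3] bad votes the invariant makes the good weight exceed twice the bad
   weight. So some candidate is good, and if only one is, its counter is the larger. *)
case: ltnP => h; case g1: (good c1) h1 h2 => /=; case g2: (good c2) => /= h1 h2 //; lia.
Qed.

(** * Failure probability of one group and of the whole vote *)

Section Group.
Variables (u w LV s m : nat) (Delta : {set 'I_u}).
Hypotheses (LV0 : 0 < LV) (LVw : LV.*2 <= w) (us : u <= 2 ^ (w * s)) (s12 : 12 <= s).
Hypothesis (mE : m = 7 * (4 * 2 ^ s)).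
Notation d := (#|Delta|).
Notation T2 := ((s * hash_width s).-tuple 'I_(2 ^ w)).
Notation T3 := ((m * (s * hash_width s)).-tuple 'I_(2 ^ w)).

Definition copy_at (r : nat -> nat) (i : nat) : nat :=
  copy_sketch w LV s Delta (fun j => r (i * (s * hash_width s) + j)).

Definition group_value (r : nat -> nat) : nat := lowbit w (lor_upto (copy_at r) m).

Definition top_level : nat := trunc_log (2 ^ s) (2 * d).

(** If [top_level.+1 = LV], truncated subtraction makes the two alternatives coincide. *)
Definition good_value (y : nat) : bool :=
  if d == 0 then y == 0
  else (y == 2 ^ (LV.-1 - top_level)) || (y == 2 ^ (LV.-1 - top_level.+1)).

Hypothesis (jL : top_level < LV).

Lemma copy_sketch_ext r1 r2 : (forall i, i < s * hash_width s -> r1 i = r2 i) ->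
  copy_sketch w LV s Delta r1 = copy_sketch w LV s Delta r2.
Proof. by move=> E; apply: eq_bigr => x _; apply: fval_ext. Qed.

Lemma copy_sketch_lt r : copy_sketch w LV s Delta r < 2 ^ LV.
Proof.
apply: (big_ind (fun a => a < 2 ^ LV)); first by rewrite expn_gt0.
  by move=> a b; apply: lxor_lt.
by move=> x _; apply: fval_lt.
Qed.

Lemma copy_at_block (c : T3) (i : 'I_m) :
  copy_at (rnd c) i = copy_sketch w LV s Delta (rnd (block c i)).
Proof. by apply: copy_sketch_ext => j jb; rewrite rnd_block. Qed.

Definition miss : {set T2} := [set c | ~~ odd (hits LV Delta top_level c)].

(** If some copy is odd at [top_level] and no copy samples anything two or more levels deeper, the
    OR has the bit of [top_level] and none beyond that of [top_level.+1]. Whichever way the latter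
    bit falls, the lowest set bit is acceptable. *)
Lemma bad_group (c : T3) : ~~ good_value (group_value (rnd c)) ->
  d != 0 /\ ([forall i, block c i \in miss] || [exists i, block c i \in deep w LV s Delta top_level.+2]).
Proof.
rewrite /good_value; case: (eqVneq d 0) => [d0|d0].
  have D0 : Delta = set0 by apply/eqP; rewrite -cards_eq0 d0.
  rewrite /group_value; suff -> : lor_upto (copy_at (rnd c)) m = 0 by rewrite lowbit0.
  apply: nat_bit_eq0 => i; rewrite bit_lor_upto; apply/hasPn => k _.
  by rewrite /copy_at /copy_sketch D0 big_set0 bit0n.
move=> h; split=> //; apply: contraR h; rewrite negb_or negb_forall negb_exists.
case/andP=> /existsP[i0 hi0] /forallP nodeep.
rewrite inE negbK -(@bit_copy_sketch u w LV s) -copy_at_block in hi0.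
set V := lor_upto (copy_at (rnd c)) m.
have VL : V < 2 ^ LV by apply: lor_upto_lt => k; exact: copy_sketch_lt.
have Vw : V < 2 ^ w by apply: leq_trans VL _; rewrite leq_exp2l //; lia.
have Vt : bit V (LV.-1 - top_level).
  rewrite bit_lor_upto; apply/hasP; exists (val i0) => //.
  by rewrite mem_iota /= ltn_ord.
have Vlow i : i < LV.-1 - top_level.+1 -> bit V i = false.
  move=> iL; rewrite bit_lor_upto; apply/hasPn => k; rewrite mem_iota /= => km.
  rewrite (copy_at_block c (Ordinal km)).
  have -> : i = LV.-1 - (LV.-1 - i) by lia.
  rewrite bit_copy_sketch /hits big1 // => x xD.
  have := nodeep (Ordinal km); rewrite inE negb_exists => /forallP /(_ x).
  rewrite xD /= negb_exists => /forallP hx.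
  have jL' : LV.-1 - i < LV by lia.
  have := hx (Ordinal jL') => /=; rewrite negb_and => /orP[]; first by lia.
  by move=> /negbTE ->.
rewrite /group_value -/V.
case V2: (bit V (LV.-1 - top_level.+1)).
  by rewrite (lowbit_lev Vw (level_of_bits V2 Vlow)) eqxx orbT.
rewrite (@lowbit_lev w V (LV.-1 - top_level) Vw) ?eqxx //; apply: level_of_bits => // i iL.
by case: (ltnP i (LV.-1 - top_level.+1)) => [/Vlow //|ge]; have -> : i = LV.-1 - top_level.+1 by lia.
Qed.

Lemma card_bad_group :
  #|[set c : T3 | ~~ good_value (group_value (rnd c))]| * 64 <= #|{: T3}|.
Proof.
case: (eqVneq d 0) => [d0|d0].
  suff -> : [set c : T3 | ~~ good_value (group_value (rnd c))] = set0 by rewrite cards0.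
  apply/setP => c; rewrite inE in_set0; apply/idP => h.
  by have [] := bad_group h; rewrite d0.
set E := 2 ^ (s * top_level.+1); set B := 2 ^ s.
have B1 : 1 < B by rewrite -(expn0 2) ltn_exp2l //; lia.
(* Needed below because [28 * 128 <= 2 ^ 12]; this fixes the lower bound 12 on [s]. *)
have B12 : 2 ^ 12 <= B by rewrite leq_exp2l.
have d1 : 0 < 2 * d by lia.
have /andP[lo hi] := trunc_log_bounds B1 d1.
rewrite -/top_level -!expnM -/E in lo hi.
have EB : E = B * 2 ^ (s * top_level) by rewrite /E mulnS expnD.
have s0 : 0 < s by lia.
set N2 := #|{: T2}|.
have hmiss : #|miss| * (4 * B) <= (4 * B - 1) * N2.
  have bnd : 2 * d < E <= 2 * d * B by rewrite hi EB mulnC leq_mul2r lo orbT.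
  have := card_odd_hits LV0 LVw us s0 jL bnd.
  rewrite -/N2 -/B; set O := #|_| => h.
  have -> : #|miss| = N2 - O.
    rewrite /N2 -cardsT -cardsDS ?subsetT //; apply: eq_card => c.
    by rewrite !inE andbT.
  nia.
have hdeep : #|deep w LV s Delta top_level.+2| * B ^ 2 <= N2.
  have := @card_deep u w LV s LV0 LVw us s0 Delta top_level.+2.
  have -> : 2 ^ (s * top_level.+3) = E * B ^ 2.
    by rewrite /E /B -expnM -expnD; congr (2 ^ _); lia.
  rewrite -/N2 => h; have E0 : 0 < E by rewrite expn_gt0.
  by rewrite -(leq_pmul2r E0); nia.
set N3 := #|{: T3}|.
have N3E : N3 = N2 ^ m by rewrite /N3 /N2 !card_tuple -expnM mulnC.
(* A copy misses with probability at most [1 - 1 / (4 * B)], so [4 * B] copies all miss with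
   probability at most 1/2, and seven times as many with probability at most 1/128. *)
have p1 : #|[set c : T3 | [forall i, block c i \in miss]]| * 128 <= N3.
  rewrite card_all_blocks; set r := 4 * B in hmiss.
  have r0 : 0 < r by rewrite /r; lia.
  have rm : 0 < r ^ m by rewrite expn_gt0 r0.
  have h1 : #|miss| ^ m * r ^ m <= (r - 1) ^ m * N3.
    by rewrite N3E -!expnMn leq_exp2r // mE; lia.
  have h2 : (r - 1) ^ m * 128 <= r ^ m.
    have := expn_pred_half r0; rewrite mE -/B -/r => h.
    have : (2 * (r - 1) ^ r) ^ 7 <= (r ^ r) ^ 7 by rewrite leq_exp2r.
    by rewrite expnMn -!expnM mulnC [r * 7]mulnC.
  rewrite -(leq_pmul2r rm) mulnAC; apply: leq_trans (leq_mul h1 (leqnn 128)) _.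
  by rewrite mulnAC mulnC leq_mul2l h2 orbT.
(* Each of the [28 * B] copies is deep with probability at most [1 / B ^ 2], so some copy is with
   probability at most [28 / B <= 1 / 128]. *)
have p2 : #|[set c : T3 | [exists i, block c i \in deep w LV s Delta top_level.+2]]| * 128 <= N3.
  have := card_some_block m (deep w LV s Delta top_level.+2 : {set T2}).
  rewrite -/N2 -/N3; set S := #|_|; set Dp := #|_| in hdeep *; rewrite mE -/B => h.
  have N20 : 0 < N2 by rewrite /N2 card_tuple expn_gt0 card_ord expn_gt0.
  have B20 : 0 < B ^ 2 by rewrite expn_gt0; lia.
  have h1 : S * B ^ 2 * N2 <= 28 * B * N3 * N2.
    rewrite mulnAC; apply: leq_trans (leq_mul h (leqnn (B ^ 2))) _.
    have -> : 7 * (4 * B) * Dp * N3 * B ^ 2 = 28 * B * N3 * (Dp * B ^ 2) by ring.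
    by rewrite leq_mul2l hdeep orbT.
  have h3 : S * B <= 28 * N3.
    have : B * (S * B) <= B * (28 * N3).
      rewrite -(leq_pmul2r N20); apply: leq_trans (leq_trans h1 _); apply/eq_leq; ring.
    by rewrite leq_pmul2l //; lia.
  have h4 : S * (128 * 28) <= S * B by rewrite leq_mul2l (leq_trans _ B12) ?orbT.
  by lia.
apply: (@leq_trans ((#|[set c : T3 | [forall i, block c i \in miss]]| +
   #|[set c : T3 | [exists i, block c i \in deep w LV s Delta top_level.+2]]|) * 64)); last by lia.
rewrite leq_mul2r /=; apply: leq_trans (leq_card_setU _ _); apply: subset_leq_card.
by apply/subsetP => c; rewrite !inE => h; have [] := bad_group h.
Qed.

Definition bad_groups (G : nat) (rho : (G * (m * (s * hash_width s))).-tuple 'I_(2 ^ w)) : nat :=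
  \sum_(g < G) ~~ good_value (group_value (rnd (block rho g))).

(* Chernoff bound via the moment 64 ^ #bad. *)
Lemma card_bad_majority (G : nat) :
  #|[set rho | G <= 3 * @bad_groups G rho]| * 2 ^ G <=
  #|{: (G * (m * (s * hash_width s))).-tuple 'I_(2 ^ w)}|.
Proof.
set N4 := #|{: (G * (m * (s * hash_width s))).-tuple 'I_(2 ^ w)}|; set N3 := #|{: T3}|.
have N4E : N4 = N3 ^ G by rewrite /N4 /N3 !card_tuple -expnM mulnC.
pose phi (c : T3) := 64 ^ (~~ good_value (group_value (rnd c))).
have sphi : \sum_c phi c <= 2 * N3.
  have -> : \sum_c phi c = \sum_(c : T3) (1 + 63 * (~~ good_value (group_value (rnd c)))).
    by apply: eq_bigr => c _; rewrite /phi; case: good_value.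
  rewrite big_split /= sum1_card -big_distrr /=.
  have -> : \sum_(c : T3) ~~ good_value (group_value (rnd c)) =
     #|[set c : T3 | ~~ good_value (group_value (rnd c))]|.
    rewrite -sum1_card [RHS]big_mkcond /=; apply: eq_bigr => c _.
    by rewrite inE; case: good_value.
  by have := card_bad_group; rewrite -/N3; set b := #|_|; lia.
(* At least [G / 3] bad groups force [64 ^ #bad >= 4 ^ G], whereas each group contributes a mean of
   at most [1 + 63 / 64 <= 2] to the moment; the quotient is [2 ^ -G]. *)
have le : #|[set rho | G <= 3 * @bad_groups G rho]| * 4 ^ G <= (2 * N3) ^ G.
  apply: (@leq_trans (\sum_rho 64 ^ @bad_groups G rho)).
    rewrite -sum_nat_const big_mkcond /=; apply: leq_sum => rho _.
    rewrite inE; case: ifP => // h.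
    by rewrite (_ : 64 = 4 ^ 3) // -expnM leq_exp2l.
  have -> : \sum_rho 64 ^ @bad_groups G rho = \sum_rho \prod_(g < G) phi (block rho g).
    by apply: eq_bigr => rho _; rewrite /bad_groups expn_sum.
  rewrite (sum_blocks (fun _ => phi)) prod_nat_const card_ord.
  by case: G {N4 N4E} => // G; rewrite leq_exp2r.
have p0 : 0 < 2 ^ G by rewrite expn_gt0.
rewrite -(leq_pmul2r p0) -mulnA -expnMn N4E; apply: leq_trans le _.
by rewrite expnMn mulnC.
Qed.

(** An acceptable [y] yields [B ^ e] with [e] equal to [top_level] or its successor, and [2 * d]
    lies between the powers of [B] with these exponents. For [d = 0] the convention [x %/ 0 = 0]
    gives the estimate 0. *)
Lemma good_value_estimate y : good_value y ->
  within_factor (2 * 2 ^ s) d ((2 ^ LV.-1 %/ y) ^ s).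
Proof.
rewrite /good_value /within_factor; case: (eqVneq d 0) => [->|d0] h.
  by rewrite (eqP h) divn0 exp0n //; lia.
set B := 2 ^ s.
have B1 : 1 < B by rewrite -(expn0 2) ltn_exp2l //; lia.
have d1 : 0 < 2 * d by lia.
have /andP[lo hi] := trunc_log_bounds B1 d1; rewrite -/top_level in lo hi.
have key : exists2 e, (2 ^ LV.-1 %/ y) ^ s = B ^ e & top_level <= e <= top_level.+1.
  have dv k : k < LV -> (2 ^ LV.-1 %/ 2 ^ (LV.-1 - k)) ^ s = B ^ k.
    move=> kL; have {1}-> : LV.-1 = k + (LV.-1 - k) by lia.
    by rewrite expnD mulnK ?expn_gt0 // -!expnM mulnC.
  case/orP: h => /eqP ->; first by exists top_level; rewrite ?dv // leqnn leqnSn.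
  case: (ltnP top_level.+1 LV) => jL'; first by exists top_level.+1; rewrite ?dv // leqnn leqnSn.
  exists top_level; last by rewrite leqnn leqnSn.
  by rewrite -dv //; congr ((_ %/ 2 ^ _) ^ _); lia.
have [e -> /andP[e1 e2]] := key.
have h1 : B ^ top_level <= B ^ e by rewrite leq_exp2l.
have h2 : B ^ e <= B ^ top_level.+1 by rewrite leq_exp2l.
rewrite expnS in hi h2; apply/andP; split; nia.
Qed.

End Group.

(** * Straight-line code and counting loops *)

Section Logic.
Variables (w : nat) (rho : nat -> nat).

Fixpoint straight (p : cmd) : bool :=
  match p with
  | CSeq p q | CIf _ p q => straight p && straight q
  | CWhile _ _ => false
  | _ => true
  end.

(** An upper bound read off the text alone: both branches of a conditional are added, so it depends
    on no state. *)
Fixpoint cost (p : cmd) : nat :=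
  match p with
  | CSeq p q => cost p + cost q
  | CIf _ p q => (cost p + cost q).+1
  | _ => 1
  end.

Fixpoint eval (p : cmd) (s : state) : state :=
  match p with
  | CSkip | CWhile _ _ => s
  | CSet r v => set_wreg w s r v
  | COp o r a b => set_wreg w s r (eval_binop w o (wreg s a) (wreg s b))
  | CISet i v => set_ireg s i v
  | CIMov i j => set_ireg s i (ireg s j)
  | CIInc i => set_ireg s i (ireg s i).+1
  | CIDec i => set_ireg s i (ireg s i).-1
  | CIAdd i a => set_ireg s i (ireg s i + wreg s a)
  | CILt r i j => set_wreg w s r (ireg s i < ireg s j)
  | CLoad r A i => set_wreg w s r (arr s A (ireg s i))
  | CStore A i r => set_mem s A (ireg s i) (wreg s r)
  | CRand r i => set_wreg w s r (rho (ireg s i))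
  | CSeq p q => eval q (eval p s)
  | CIf r p q => if wreg s r == 0 then eval q s else eval p s
  end.

Definition runs (p : cmd) (s : state) (T : nat) (s' : state) : Prop :=
  exists2 t, exec w rho p s t s' & t <= T.

Lemma straight_runs p s : straight p -> runs p s (cost p) (eval p s).
Proof.
elim: p s => //=; try by move=> *; exists 1 => //; constructor.
  move=> p IHp q IHq s /andP[/IHp Hp /IHq Hq].
  have [t1 e1 h1] := Hp s; have [t2 e2 h2] := Hq (eval p s).
  by exists (t1 + t2); [econstructor; eassumption|exact: leq_add].
move=> r p IHp q IHq s /andP[/IHp Hp /IHq Hq].
case: eqP => [r0|/eqP r0].
  have [t e h] := Hq s; exists t.+1; first exact: ExecIfFalse.
  by apply: leq_trans h _; lia.
have [t e h] := Hp s; exists t.+1; first exact: ExecIfTrue.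
by apply: leq_trans (leq_addr _ _).
Qed.

Lemma runs_seq p q s s1 s2 T1 T2 :
  runs p s T1 s1 -> runs q s1 T2 s2 -> runs (CSeq p q) s (T1 + T2) s2.
Proof.
move=> [t1 e1 h1] [t2 e2 h2].
by exists (t1 + t2); [econstructor; eassumption|exact: leq_add].
Qed.

Lemma runs_if r p q s s' T :
  runs (if wreg s r == 0 then q else p) s T s' -> runs (CIf r p q) s T.+1 s'.
Proof.
case: eqP => [r0|/eqP r0] [t e h]; exists t.+1 => //; [exact: ExecIfFalse|exact: ExecIfTrue].
Qed.

(** Repetition in the program text. It is used only for counts determined by [s], which may enter
    the program itself. *)
Fixpoint rep (n : nat) (p : cmd) : cmd :=
  if n is n'.+1 then CSeq (rep n' p) p else CSkip.

Lemma straight_rep n p : straight p -> straight (rep n p).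
Proof. by move=> sp; elim: n => //= n ->. Qed.

Definition for_loop (r i n : nat) (body : cmd) : cmd :=
  CSeq (CISet i 0) (CSeq (CILt r i n)
    (CWhile r (CSeq body (CSeq (CIInc i) (CILt r i n))))).

(** Loop control overwrites the counter and the flag between two runs of the body, so [Inv] must be
    insensitive to both. A turn costs the body plus increment, comparison and test. *)
Lemma for_loop_runs (Inv : nat -> state -> Prop) r i n body N Tb s :
  0 < w -> i != n -> straight body ->
  (forall j s, Inv j s -> ireg s n = N) ->
  (forall j s v b, Inv j s -> Inv j (set_wreg w (set_ireg s i v) r b)) ->
  (forall j s, j < N -> Inv j s -> ireg s i = j ->
    Inv j.+1 (eval body s) /\ ireg (eval body s) i = ireg s i) ->
  cost body <= Tb ->
  Inv 0 s ->
  exists2 s', runs (for_loop r i n body) s (N * (Tb + 3) + 3) s' & Inv N s'.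
Proof.
move=> w0 ineqn sb nN stab step cb I0.
have w1 b : ((nat_of_bool b) %% 2 ^ w == 0) = ~~ b.
  have : 1 < 2 ^ w by rewrite -(expn0 2) ltn_exp2l.
  by case: b => h; rewrite modn_small //; lia.
pose st j s := set_wreg w (set_ireg s i j) r (j < N).
have loop k j s0 : j + k = N -> Inv j (st j s0) ->
  exists2 s', runs (CWhile r (CSeq body (CSeq (CIInc i) (CILt r i n)))) (st j s0)
     (k * (Tb + 3) + 1) s' & Inv N s'.
  elim: k j s0 => [|k IH] j s0.
    rewrite addn0 => jN I; exists (st j s0); last by rewrite -jN.
    exists 1 => //; apply: ExecWhileFalse; apply/eqP.
    by rewrite /st /= /put eqxx w1 jN ltnn.
  move=> jk I; have jN : j < N by lia.
  have ij : ireg (st j s0) i = j by rewrite /st /= /put eqxx.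
  have [I1 Ei] := step _ _ jN I ij.
  rewrite ij in Ei.
  have I2 : Inv j.+1 (st j.+1 (eval body (st j s0))) by apply: stab.
  have jk' : j.+1 + k = N by lia.
  have [s' [t e h] IN] := IH _ _ jk' I2.
  exists s' => //.
  have [tb eb hb] := straight_runs (st j s0) sb.
  exists (tb + (1 + 1) + t).+1; last by lia.
  apply: ExecWhileTrue (e); first by rewrite /st /= /put eqxx w1 jN.
  apply: ExecSeq eb _; apply: ExecSeq; first exact: ExecIInc.
  have := ExecILt w rho r i n (set_ireg (eval body (st j s0)) i (ireg (eval body (st j s0)) i).+1).
  rewrite Ei /= {1 2}/put eqxx eq_sym (negbTE ineqn).
  by rewrite (nN _ _ I1).
have I0' : Inv 0 (st 0 s) by apply: stab.
have [s' [t e h] IN] := loop N 0 s erefl I0'.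
exists s' => //; exists (1 + (1 + t)); last by lia.
apply: ExecSeq; first exact: ExecISet.
apply: ExecSeq (e); have := ExecILt w rho r i n (set_ireg s i 0).
by rewrite /= {1 2}/put eqxx eq_sym (negbTE ineqn) (nN _ _ I0).
Qed.

(** A syntactic frame condition, so that preservation of registers follows without evaluating
    unrolled code. *)
Fixpoint writes_from (kw ki : nat) (p : cmd) : bool :=
  match p with
  | CSet r _ | COp _ r _ _ | CILt r _ _ | CLoad r _ _ | CRand r _ => kw <= r
  | CISet i _ | CIMov i _ | CIInc i | CIDec i | CIAdd i _ => ki <= i
  | CSeq p q | CIf _ p q => writes_from kw ki p && writes_from kw ki q
  | CWhile _ p => writes_from kw ki p
  | _ => true
  end.

Fixpoint stores_to (A : nat) (p : cmd) : bool :=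
  match p with
  | CStore B _ _ => B == A
  | CSeq p q | CIf _ p q => stores_to A p || stores_to A q
  | CWhile _ p => stores_to A p
  | _ => false
  end.

Lemma writes_rep kw ki n p : writes_from kw ki p -> writes_from kw ki (rep n p).
Proof. by move=> h; elim: n => //= n ->. Qed.

Lemma stores_rep A n p : ~~ stores_to A p -> ~~ stores_to A (rep n p).
Proof. by move=> h; elim: n => //= n IH; rewrite negb_or IH. Qed.

Lemma put_neq (T : Type) (f : nat -> T) k v j : j != k -> put f k v j = f j.
Proof. by rewrite /put => /negbTE ->. Qed.

Lemma eval_wreg kw ki p s r : writes_from kw ki p -> r < kw -> wreg (eval p s) r = wreg s r.
Proof.
move=> wp rk; elim: p s wp => //=;
  try by move=> *; rewrite put_neq // neq_ltn (leq_trans rk).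
  by move=> p IHp q IHq s /andP[hp hq]; rewrite IHq // IHp.
by move=> r' p IHp q IHq s /andP[hp hq]; case: ifP => _; rewrite ?IHq ?IHp.
Qed.

Lemma eval_ireg kw ki p s i : writes_from kw ki p -> i < ki -> ireg (eval p s) i = ireg s i.
Proof.
move=> wp rk; elim: p s wp => //=;
  try by move=> *; rewrite put_neq // neq_ltn (leq_trans rk).
  by move=> p IHp q IHq s /andP[hp hq]; rewrite IHq // IHp.
by move=> r' p IHp q IHq s /andP[hp hq]; case: ifP => _; rewrite ?IHq ?IHp.
Qed.

Lemma eval_arr A p s : ~~ stores_to A p -> arr (eval p s) A = arr s A.
Proof.
elim: p s => //=.
- by move=> B i r s; rewrite eq_sym => BA; rewrite put_neq.
- by move=> p IHp q IHq s; rewrite negb_or => /andP[hp hq]; rewrite IHq // IHp.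
by move=> r' p IHp q IHq s; rewrite negb_or => /andP[hp hq]; case: ifP => _; rewrite ?IHq ?IHp.
Qed.

End Logic.

(** * Programs on packed sketches *)

Fixpoint block_of (l : seq cmd) : cmd :=
  match l with
  | [::] => CSkip
  | [:: p] => p
  | p :: l' => CSeq p (block_of l')
  end.

(* Word registers: 0-6 constants (wpar), 7 and 8 the candidates of the vote,
   9 OR of a group, 10 the power of two of the current field, 11 AND of one-hot
   words, 12 hash value, 13-16 temporary, 20 loop flag.
   Index registers: 0-4 constants (ipar), 5 loop counter, 6 and 7 the counters of
   the vote, 8 field within the word, 9 word of the sketch, 10 random word,
   11 word of the element. *)
Definition hash_word : cmd := block_of
  [:: CLoad 13 ARG 11;
      CRand 14 10; CIInc 10; COp Mod 15 13 1; COp Mul 15 15 14; COp Add 12 12 15;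
      CRand 14 10; CIInc 10; COp Div 15 13 1; COp Mul 15 15 14; COp Add 12 12 15;
      CIInc 11].

Definition lowbit_cmd (r t : nat) : cmd :=
  CSeq (COp Defs.Sub t 0 r) (COp And t t r).

Definition hash_cmd (s : nat) : cmd := block_of
  [:: CRand 12 10; CIInc 10; CISet 11 0; rep s hash_word;
      COp Div 12 12 1; lowbit_cmd 12 13; COp Div 13 2 13; COp And 11 11 13].

Definition fval_cmd (s : nat) : cmd := CSeq (COp Add 11 3 0) (rep s (hash_cmd s)).

Definition advance : cmd := block_of
  [:: COp Mul 10 10 4; CIInc 8; CILt 16 8 1;
      CIf 16 CSkip (block_of [:: CISet 8 0; CIInc 9; COp Add 10 5 0])].

Definition update_copy (s : nat) : cmd := block_of
  [:: fval_cmd s; COp Mul 15 11 10; CLoad 16 SKETCH 9; COp Xor 16 16 15;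
      CStore SKETCH 9 16; advance].

Definition update_big (s : nat) : cmd :=
  CSeq (COp Add 10 5 0) (for_loop 20 5 0 (update_copy s)).

Section Programs.
Variables (w LV s K T G : nat) (rho : nat -> nat).
Hypotheses (LV0 : 0 < LV) (LVw : LV.*2 <= w).

Let w0 : 0 < w. Proof. by lia. Qed.
Let f := w %/ LV.
Let D := 2 ^ (w - LV).

Definition wpar : seq nat := [:: 0; D; 2 ^ LV.-1; 2 ^ LV - 1; 2 ^ LV; 1; 1].
Definition ipar : seq nat := [:: K; f; T; G; 0].

Definition env (st : state) : Prop :=
  (forall r, r < 7 -> wreg st r = nth 0 wpar r) /\ (forall i, i < 5 -> ireg st i = nth 0 ipar i).

Lemma env_eval p st : writes_from 7 5 p -> env st -> env (eval w rho p st).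
Proof.
move=> wp [e1 e2]; split=> [r r6|i i5]; first by rewrite (eval_wreg _ _ _ wp) // e1.
by rewrite (eval_ireg _ _ _ wp) // e2.
Qed.

Lemma evalS n p st : eval w rho (rep n.+1 p) st = eval w rho p (eval w rho (rep n p) st).
Proof. by []. Qed.

Lemma pow_lt k : k < w -> 2 ^ k < 2 ^ w.
Proof. by move=> kw; rewrite ltn_exp2l. Qed.

Lemma eval_hash_word X st : wreg st 1 = D -> arr st ARG =1 X -> (forall k, X k < 2 ^ w) ->
  let st' := eval w rho hash_word st in let i := ireg st 10 in let k := ireg st 11 in
  [/\ wreg st' 12 = (wreg st 12 + (X k %% D * rho i + X k %/ D * rho i.+1)) %% 2 ^ w,
      ireg st' 10 = i.+2 & ireg st' 11 = k.+1].
Proof.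
move=> hD hX Xw; split=> //=; rewrite /put /= hX hD.
rewrite !(modn_small (Xw _)) !(modn_mod, modnDml, modnDmr, modnMml, modnMmr).
rewrite -addnA -modnDmr -[in RHS]modnDmr; congr ((_ + _) %% _).
by rewrite modnDml -modnDmr modnMml modnMmr modnDmr.
Qed.

(** The case [n = 0] stands apart because register 12 is reduced modulo [2 ^ w] only once a word has
    been added. *)
Lemma eval_hash_words X st n : wreg st 1 = D -> arr st ARG =1 X -> (forall k, X k < 2 ^ w) ->
  ireg st 11 = 0 ->
  let st' := eval w rho (rep n hash_word) st in let i := ireg st 10 in
  [/\ wreg st' 12 = (wreg st 12 + \sum_(j < n.*2) digit D X j * rho (i + j)) %% 2 ^ w
      \/ n = 0 /\ wreg st' 12 = wreg st 12,
      ireg st' 10 = i + n.*2 & ireg st' 11 = n].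
Proof.
move=> hD hX Xw i0; elim: n => [|n [IH1 IH2 IH3]].
  by split; [right|rewrite /= addn0|].
have wr : writes_from 10 10 (rep n hash_word) by exact: writes_rep.
have sr : ~~ stores_to ARG (rep n hash_word) by exact: stores_rep.
rewrite evalS; lazy zeta.
have [] := @eval_hash_word X (eval w rho (rep n hash_word) st); rewrite ?(@eval_wreg _ _ _ _ _ _ 1 wr) ?(eval_arr _ _ _ sr) //.
rewrite IH2 IH3 => -> -> ->; split; last by []; last by rewrite doubleS !addnS.
left; rewrite doubleS !big_ord_recr /=.
have -> : digit D X n.*2 = X n %% D by rewrite /digit odd_double doubleK.
have -> : digit D X n.*2.+1 = X n %/ D by rewrite /digit /= odd_double /= uphalf_double.
rewrite !addnS.
case: IH1 => [->|[n0 ->]]; last by rewrite n0 !big_ord0 !addn0 /=; congr (_ %% _); lia.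
by rewrite modnDml !addnA.
Qed.

Lemma eval_hash X st : env st -> arr st ARG =1 X -> (forall k, X k < 2 ^ w) ->
  wreg st 11 < 2 ^ w -> 0 < s ->
  let st' := eval w rho (hash_cmd s) st in let i := ireg st 10 in
  wreg st' 11 = Nat.land (wreg st 11) (onehot w LV s (fun j => rho (i + j)) X)
  /\ ireg st' 10 = i + hash_width s.
Proof.
move=> [ew ei] hX Xw aw s0.
pose st0 := eval w rho (block_of [:: CRand 12 10; CIInc 10; CISet 11 0]) st.
have wr : writes_from 12 10 (rep s hash_word) by exact: writes_rep.
have [] := @eval_hash_words X st0 s (ew 1 isT) hX Xw erefl.
set st1 := eval w rho (rep s hash_word) st0 => h1 h2 _.
have e1 r : r < 12 -> wreg st1 r = wreg st r.
  by move=> r12; rewrite (eval_wreg _ _ _ wr) // /st0 /= put_neq //; lia.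
have -> : eval w rho (hash_cmd s) st =
   eval w rho (block_of [:: COp Div 12 12 1; lowbit_cmd 12 13; COp Div 13 2 13; COp And 11 11 13]) st1 by [].
have z12 : wreg st1 12 = digit_sum D (fun j => rho (ireg st 10 + j)) X s %% 2 ^ w.
  case: h1 => [->|[] ?]; last by lia.
  rewrite /st0 /= /put /= /digit_sum modnDml addn0; congr ((_ + _) %% _).
  by apply: eq_bigr => j _; rewrite addnS.
split; last by rewrite /= h2 /st0 /= /put /= /hash_width addnS.
rewrite /= /put /= z12 !e1 // (ew 0) // (ew 1) // (ew 2) //= /eval_binop -/(hash w D (fun j => rho (ireg st 10 + j)) X s).
have hw : w - LV <= w by exact: leq_subr.
have := @hash_lt s (w - LV) w hw (fun j => rho (ireg st 10 + j)) X.
rewrite -/D; set v := hash _ _ _ _ _ => vL.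
have vw : v < 2 ^ w by apply: leq_trans vL _; rewrite leq_exp2l //; lia.
rewrite !(modn_small vw) add0n !modn_mod.
rewrite -/(lowbit w v) /onehot -/D -/v.
have lw : lowbit w v < 2 ^ w by exact: land_lt.
rewrite !(modn_small lw).
have pw : 2 ^ LV.-1 %/ lowbit w v < 2 ^ w.
  apply: leq_ltn_trans (leq_div _ _) _; apply: pow_lt; lia.
rewrite !(modn_small pw) modn_small //.
exact: land_lt.
Qed.

Lemma hash_writes : writes_from 11 10 (hash_cmd s).
Proof. by rewrite /= writes_rep. Qed.

Lemma hash_stores A : ~~ stores_to A (hash_cmd s).
Proof. by rewrite /= orbF stores_rep. Qed.

Lemma eval_fval X st : env st -> arr st ARG =1 X -> (forall k, X k < 2 ^ w) -> 0 < s ->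
  let st' := eval w rho (fval_cmd s) st in let i := ireg st 10 in
  wreg st' 11 = fval w LV s (fun j => rho (i + j)) X s /\ ireg st' 10 = i + s * hash_width s.
Proof.
move=> en hX Xw s0; rewrite /fval_cmd /=.
set st0 := set_wreg _ _ _ _.
have en0 : env st0.
  by apply: (@env_eval (COp Add 11 3 0)).
have a0 : wreg st0 11 = 2 ^ LV - 1.
  rewrite /st0 /= /put /=; case: en => ew _; rewrite (ew 3) // (ew 0) //= /eval_binop addn0 modn_mod modn_small //.
  by apply: leq_ltn_trans (leq_subr _ _) _; apply: pow_lt; lia.
have Lw : 2 ^ LV <= 2 ^ w by rewrite leq_exp2l //; lia.
have wr n : writes_from 7 5 (rep n (hash_cmd s)) by apply: writes_rep; rewrite /= writes_rep.
have sr n : ~~ stores_to ARG (rep n (hash_cmd s)) by apply/stores_rep/hash_stores.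
suff H n : let st' := eval w rho (rep n (hash_cmd s)) st0 in
  wreg st' 11 = fval w LV s (fun j => rho (ireg st 10 + j)) X n /\ ireg st' 10 = ireg st 10 + n * hash_width s.
  exact: H.
elim: n => [|n [IH1 IH2]]; first by rewrite /= addn0.
rewrite evalS; lazy zeta.
have [||//||//|] := @eval_hash X (eval w rho (rep n (hash_cmd s)) st0).
- exact: env_eval.
- by rewrite (eval_arr _ _ _ (sr n)).
- rewrite IH1; apply: leq_trans (fval_lt _ _ _ _ _ _) Lw.
move=> -> ->; rewrite IH1 IH2; split; last by rewrite mulSn; lia.
rewrite /=; congr (Nat.land _ _).
by rewrite /onehot; congr (_ %/ lowbit _ _); apply: hash_ext => j _; rewrite addnA.
Qed.

(* The fields of LV bits do not straddle words: word k holds fields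
   f k, ..., f k + f - 1. *)
Definition at_field (i : nat) (st : state) : Prop :=
  [/\ wreg st 10 = 2 ^ (LV * (i %% f)), ireg st 8 = i %% f & ireg st 9 = i %/ f].

Lemma f_gt1 : 1 < f.
Proof. by rewrite /f leq_divRL; lia. Qed.

Lemma field_fits i : LV * (i %% f) + LV <= w.
Proof.
have : i %% f < f by rewrite ltn_pmod // ltnW // f_gt1.
have := leq_divM w LV; rewrite -/f; nia.
Qed.

Lemma eval_advance i st : env st -> at_field i st -> at_field i.+1 (eval w rho advance st).
Proof.
move=> [ew ei] [h1 h2 h3]; have f1 := f_gt1; have f0 : 0 < f by lia.
have w1 b : ((nat_of_bool b) %% 2 ^ w == 0) = ~~ b.
  have : 1 < 2 ^ w by rewrite -(expn0 2) ltn_exp2l.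
  by case: b => h; rewrite modn_small //; lia.
have iE := divn_eq i f; have il := ltn_pmod i f0.
rewrite /advance /= {1}/put /= {1}/put /= w1 h2.
rewrite {1}/put /= (ei 1) //=.
case: ltnP => hi /=.
  have [e1 e2] : i.+1 %% f = (i %% f).+1 /\ i.+1 %/ f = i %/ f.
    have iE' : i.+1 = i %/ f * f + (i %% f).+1 by lia.
    split; rewrite iE'; first by rewrite modnMDl modn_small.
    by rewrite divnMDl // [(i %% f).+1 %/ f]divn_small // addn0.
  split; rewrite /= /put /= ?e1 ?e2 //.
  rewrite h1 (ew 4) //= /eval_binop -expnD addnC -mulnS modn_mod modn_small // pow_lt //.
  by have := field_fits i.+1; rewrite e1; lia.
have [e1 e2] : i.+1 %% f = 0 /\ i.+1 %/ f = (i %/ f).+1.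
  have iE' : i.+1 = (i %/ f).+1 * f by rewrite mulSn; lia.
  by rewrite iE' modnMl mulnK.
split; rewrite /= /put /= ?e1 ?e2 ?h3 // muln0 (ew 5) // (ew 0) //= /eval_binop addn0 modn_mod modn_small //.
by rewrite -(expn0 2) ltn_exp2l.
Qed.

End Programs.

Definition merge_cmd : cmd := for_loop 20 5 2 (block_of
  [:: CLoad 16 SKETCH 5; CLoad 17 ARG 5; COp Xor 16 16 17; CStore SKETCH 5 16]).

Lemma merge_runs w rho T a b st : 0 < w -> ireg st 2 = T ->
  a < 2 ^ (w * T) -> b < 2 ^ (w * T) ->
  arr st SKETCH =1 words w a -> arr st ARG =1 words w b ->
  exists2 st', runs w rho merge_cmd st (T * 7 + 3) st' & arr st' SKETCH =1 words w (Nat.lxor a b).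
Proof.
move=> w0 hT aT bT ha hb.
set body := block_of [:: CLoad 16 SKETCH 5; CLoad 17 ARG 5; COp Xor 16 16 17; CStore SKETCH 5 16].
pose Inv j s := [/\ ireg s 2 = T, arr s ARG =1 words w b &
  forall k, arr s SKETCH k = if k < j then words w (Nat.lxor a b) k else words w a k].
have nN j s : Inv j s -> ireg s 2 = T by case.
have stab j s v c : Inv j s -> Inv j (set_wreg w (set_ireg s 5 v) 20 c) by [].
have I0 : Inv 0 st by split.
have step j s : j < T -> Inv j s -> ireg s 5 = j ->
    Inv j.+1 (eval w rho body s) /\ ireg (eval w rho body s) 5 = ireg s 5.
  move=> jT [h1 h2 h3] sj; split=> //; split=> // k.
  rewrite /= /put /= sj /eval_binop; case: (eqVneq k j) => [->|kj].
    rewrite h3 h2 ltnn ltnSn words_lxor !modn_small ?lxor_lt ?words_lt //.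
  by rewrite h3 [in RHS]ltnS [in RHS]leq_eqVlt (negbTE kj).
have [s' r [_ _ h]] := @for_loop_runs w rho Inv 20 5 2 body T 4 st w0 isT isT nN stab step isT I0.
(* Cells from [T] on are never touched; both numbers are below [2 ^ (w * T)], so these cells are
   zero before and after. *)
exists s' => // k; rewrite h; case: ltnP => // Tk.
by rewrite !(@words_big _ _ _ (w * T)) // ?lxor_lt // leq_mul2l Tk orbT.
Qed.

(** * Bit positions of the packed fields *)

Section Layout.
Variables (w LV s : nat).
Hypotheses (LV0 : 0 < LV) (LVw : LV.*2 <= w).
Let f := w %/ LV.

Definition pos (i : nat) : nat := w * (i %/ f) + LV * (i %% f).

Lemma pos_step i : pos i + LV <= pos i.+1.
Proof.
have f1 := f_gt1 LV0 LVw; have fits := field_fits LV0 LVw i; rewrite -/f in f1 fits *.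
have f0 : 0 < f by lia.
have iE := divn_eq i f; have il := ltn_pmod i f0; rewrite /pos.
case: (ltnP (i %% f).+1 f) => hi.
  have iE' : i.+1 = i %/ f * f + (i %% f).+1 by lia.
  have -> : i.+1 %/ f = i %/ f by rewrite iE' divnMDl // [(i %% f).+1 %/ f]divn_small // addn0.
  have -> : i.+1 %% f = (i %% f).+1 by rewrite iE' modnMDl modn_small.
  by rewrite mulnS; lia.
have iE' : i.+1 = (i %/ f).+1 * f by rewrite mulSn; lia.
rewrite iE' modnMl mulnK // mulnS muln0; lia.
Qed.

Lemma pos_lt i j : i < j -> pos i + LV <= pos j.
Proof.
elim: j => // j IH; rewrite ltnS leq_eqVlt => /orP[/eqP <-|/IH h]; first exact: pos_step.
by apply: leq_trans h (leq_trans (leq_addr _ _) (pos_step j)).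
Qed.

Lemma pos_le i j : i <= j -> pos i <= pos j.
Proof.
by rewrite leq_eqVlt => /orP[/eqP ->|/pos_lt h] //; apply: leq_trans h; exact: leq_addr.
Qed.

Definition field (Y i : nat) : nat := (Y %/ 2 ^ pos i) %% 2 ^ LV.

Lemma bit_field Y i j : bit (field Y i) j = (j < LV) && bit Y (pos i + j).
Proof. by rewrite /field bit_mod bit_div. Qed.

Lemma field_lt Y i : field Y i < 2 ^ LV.
Proof. by rewrite ltn_pmod ?expn_gt0. Qed.

Lemma field0 i : field 0 i = 0.
Proof. by rewrite /field div0n mod0n. Qed.

Lemma field_lxor a b i : field (Nat.lxor a b) i = Nat.lxor (field a i) (field b i).
Proof. by apply: bit_inj => j; rewrite !(bitE, bit_field); case: (j < LV). Qed.

Lemma field_single v i j : v < 2 ^ LV -> field (v * 2 ^ pos j) i = if i == j then v else 0.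
Proof.
move=> vL; apply: bit_inj => k; rewrite bit_field bit_mul.
case: (ltnP k LV) => kL /=; last first.
  by case: eqP => _; rewrite ?bit0n // (bit_small vL kL).
case: (ltngtP i j) => [ij|ji|->]; last by rewrite leq_addr addKn.
  by rewrite bit0n leqNgt; have := pos_lt ij; case: ltnP => //=; lia.
have h := pos_lt ji; rewrite bit0n (@bit_small v LV) ?andbF //; lia.
Qed.

Lemma words_single v i k : v < 2 ^ LV ->
  words w (v * 2 ^ pos i) k = if k == i %/ f then v * 2 ^ (LV * (i %% f)) else 0.
Proof.
move=> vL; rewrite /pos addnC expnD mulnA words_shift //.
apply: (@leq_trans (2 ^ LV * 2 ^ (LV * (i %% f)))); first by rewrite ltn_pmul2r ?expn_gt0.
rewrite -expnD leq_exp2l //; have := field_fits LV0 LVw i; rewrite -/f; lia.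
Qed.

Lemma field_words Y i : field Y i = (words w Y (i %/ f) %/ 2 ^ (LV * (i %% f))) %% 2 ^ LV.
Proof.
apply: bit_inj => j; rewrite bit_field bit_mod bit_div bit_wordsE.
case: (ltnP j LV) => //= jL; have := field_fits LV0 LVw i; rewrite -/f => h.
by rewrite (_ : _ + j < w) /= ?addnA //; lia.
Qed.

Definition copy_val (r X : nat -> nat) (i : nat) : nat :=
  fval w LV s (fun j => r (i * (s * hash_width s) + j)) X s.

(** At disjoint positions XOR is concatenation; this form matches the update loop, which alters one
    field per turn. *)
Fixpoint element_sketch (r X : nat -> nat) (K : nat) : nat :=
  if K is i.+1 then Nat.lxor (element_sketch r X i) (copy_val r X i * 2 ^ pos i) else 0.

Lemma copy_val_lt r X i : copy_val r X i < 2 ^ LV.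
Proof. exact: fval_lt. Qed.

Lemma element_sketch_lt r X K : element_sketch r X K < 2 ^ pos K.
Proof.
elim: K => [|K IH] /=; first by rewrite expn_gt0.
apply: lxor_lt.
  by apply: leq_trans IH _; rewrite leq_exp2l // pos_le.
apply: (@leq_trans (2 ^ (pos K + LV))); last by rewrite leq_exp2l // pos_step.
by rewrite addnC expnD ltn_pmul2r ?expn_gt0 // copy_val_lt.
Qed.

Lemma field_element_sketch r X K i : i < K -> field (element_sketch r X K) i = copy_val r X i.
Proof.
have F0 n j : n <= j -> field (element_sketch r X n) j = 0.
  elim: n => [|n IH] nj; first exact: field0.
  have vL := copy_val_lt r X n.
  rewrite [element_sketch _ _ _]/= field_lxor (IH (ltnW nj)) (field_single _ _ vL).
  by rewrite (gtn_eqF nj).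
elim: K => // K IH; rewrite ltnS leq_eqVlt => /orP iK.
have vL := copy_val_lt r X K.
rewrite [element_sketch _ _ _]/= field_lxor (field_single _ _ vL).
case: iK => [/eqP ->|iK]; first by rewrite eqxx (F0 _ _ (leqnn K)) lxor0n.
by rewrite (ltn_eqF iK) (IH iK) lxorC lxor0n.
Qed.

End Layout.

(** * The query program *)

Definition query_field : cmd := block_of
  [:: CLoad 16 SKETCH 9; COp Div 16 16 10; COp Mod 16 16 4; COp Or 9 9 16; advance].

(** The counters are index registers, since they may reach [G], which need not fit in a word. Index
    register 4 holds 0, so the comparisons with it test whether a counter is positive. *)
Definition vote_cmd : cmd :=
  CSeq (COp Eqw 16 11 7) (CIf 16 (CIInc 6)
  (CSeq (COp Eqw 16 11 8) (CIf 16 (CIInc 7)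
  (CSeq (CILt 16 4 6) (CIf 16
    (CSeq (CILt 16 4 7) (CIf 16 (CSeq (CIDec 6) (CIDec 7))
      (CSeq (COp Add 8 11 0) (CISet 7 1))))
    (CSeq (COp Add 7 11 0) (CISet 6 1))))))).

Definition group_cmd (m : nat) : cmd := block_of
  [:: CSet 9 0; rep m query_field; lowbit_cmd 9 11; vote_cmd].

(* Registers 13 and 9 hold v and a standing for v * 2 ^ (w * a). *)
Definition power_step : cmd := block_of
  [:: COp Mul 14 13 12; COp MulHi 15 13 12;
      CIf 15 (CSeq (COp Add 13 15 0) (CIInc 9)) (COp Add 13 14 0)].

Definition output_cmd (s : nat) : cmd := block_of
  [:: CILt 16 6 7; CIf 16 (COp Add 11 8 0) (COp Add 11 7 0); COp Div 12 2 11;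
      COp Add 13 5 0; CISet 9 0; rep s power_step; CStore OUT 9 13].

Definition query_big (s m : nat) : cmd :=
  CSeq (COp Add 10 5 0) (CSeq (for_loop 20 5 3 (group_cmd m)) (output_cmd s)).

(** * Correctness and running time of update and query *)

Section Runs.
Variables (w LV s K T G : nat) (rho : nat -> nat).
Hypotheses (LV0 : 0 < LV) (LVw : LV.*2 <= w) (s0 : 0 < s).

Let w0 : 0 < w. Proof. by lia. Qed.
Let f := w %/ LV.

Notation env := (env w LV K T G).
Notation at_field := (at_field w LV).
Notation evalc := (eval w rho).

Lemma bool_mod b : ((nat_of_bool b) %% 2 ^ w == 0) = ~~ b.
Proof.
have : 1 < 2 ^ w by rewrite -(expn0 2) ltn_exp2l.
by case: b => h; rewrite modn_small //; lia.
Qed.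

Lemma LV_lt_pow x : x < 2 ^ LV -> x < 2 ^ w.
Proof. by move=> xL; apply: leq_trans xL _; rewrite leq_exp2l //; lia. Qed.

Lemma eval_init st : env st -> ireg st 8 = 0 -> ireg st 9 = 0 ->
  at_field 0 (evalc (COp Add 10 5 0) st).
Proof.
move=> [ew _] h8 h9; split; rewrite ?mod0n ?div0n //= /put /= (ew 5) // (ew 0) //=.
have : 1 < 2 ^ w by rewrite -(expn0 2) ltn_exp2l.
by move=> h; rewrite /eval_binop addn0 modn_mod modn_small // muln0 expn0.
Qed.

Lemma eval_advance_ireg10 st : ireg (evalc advance st) 10 = ireg st 10.
Proof. by rewrite /=; case: ifP. Qed.

Lemma eval_update_copy X Y i st : env st -> arr st ARG =1 X -> (forall k, X k < 2 ^ w) ->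
  at_field i st -> ireg st 10 = i * (s * hash_width s) ->
  arr st SKETCH =1 words w (Nat.lxor Y (element_sketch w LV s rho X i)) ->
  let st' := evalc (update_copy s) st in
  [/\ env st', arr st' ARG =1 X, at_field i.+1 st', ireg st' 10 = i.+1 * (s * hash_width s) &
      arr st' SKETCH =1 words w (Nat.lxor Y (element_sketch w LV s rho X i.+1))].
Proof.
move=> en hX Xw hat h10 hY.
have wr0 : writes_from 11 10 (rep s (hash_cmd s)) by apply: writes_rep; exact: hash_writes.
have wr : writes_from 11 10 (fval_cmd s) by rewrite /= wr0.
have wr' : writes_from 7 5 (fval_cmd s).
  by rewrite /=; apply: writes_rep; rewrite /= writes_rep.
have sr A : ~~ stores_to A (fval_cmd s) by rewrite /=; apply/stores_rep/hash_stores.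
have [] := @eval_fval w LV s K T G rho LV0 LVw X st en hX Xw s0.
set st1 := evalc (fval_cmd s) st => v1 r1.
have en1 : env st1 by apply: env_eval.
pose st2 := evalc (block_of [:: COp Mul 15 11 10; CLoad 16 SKETCH 9; COp Xor 16 16 15;
      CStore SKETCH 9 16]) st1.
have en2 : env st2 by apply: env_eval.
have at2 : at_field i st2.
  case: hat => a1 a2 a3; split.
  - by rewrite -a1 -(@eval_wreg w rho _ _ _ st 10 wr).
  - by rewrite -a2 -(@eval_ireg w rho _ _ _ st 8 wr).
  - by rewrite -a3 -(@eval_ireg w rho _ _ _ st 9 wr).
rewrite -[evalc (update_copy s) st]/(evalc advance st2); lazy zeta.
have i10 : ireg st2 10 = i.+1 * (s * hash_width s).
  rewrite -[LHS]/(ireg st1 10) r1 h10 mulSn; lia.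
split.
- exact: env_eval.
- move=> k; rewrite eval_arr // -[LHS]/(arr st1 ARG k) /st1 (eval_arr _ _ _ (sr ARG)); exact: hX.
- exact: (eval_advance rho LV0 LVw en2 at2).
- by rewrite -[LHS]/(ireg (evalc advance st2) 10) eval_advance_ireg10.
move=> k; rewrite (@eval_arr w rho SKETCH advance) //.
case: (at2) => a1 a2 a3.
have v10 : wreg st1 10 = 2 ^ (LV * (i %% f)) by rewrite -a1.
have i9 : ireg st1 9 = i %/ f by rewrite -a3.
have sk j : arr st1 SKETCH j = words w (Nat.lxor Y (element_sketch w LV s rho X i)) j.
  by rewrite /st1 (eval_arr _ _ _ (sr SKETCH)) hY.
have vE : wreg st1 11 = copy_val w LV s rho X i by rewrite v1 /copy_val h10.
have vL : copy_val w LV s rho X i < 2 ^ LV by exact: fval_lt.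
rewrite /st2 /= /put /= i9 v10 vE /eval_binop.
have small : copy_val w LV s rho X i * 2 ^ (LV * (i %% f)) < 2 ^ w.
  apply: (@leq_trans (2 ^ LV * 2 ^ (LV * (i %% f)))); first by rewrite ltn_pmul2r ?expn_gt0.
  by rewrite -expnD leq_exp2l //; have := field_fits LV0 LVw i; rewrite -/f; lia.
rewrite lxorA words_lxor words_single // -/f.
case: eqP => [->|_]; last by rewrite lxorC lxor0n sk.
by rewrite sk !(modn_small small) !(@modn_small _ (2 ^ w)) ?lxor_lt ?words_lt.
Qed.

Lemma update_big_runs X Y st : env st -> (forall k, X k < 2 ^ w) ->
  ireg st 8 = 0 -> ireg st 9 = 0 -> ireg st 10 = 0 ->
  arr st ARG =1 X -> arr st SKETCH =1 words w Y ->
  exists2 st', runs w rho (update_big s) st (K * (cost (update_copy s) + 3) + 4) st' &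
    arr st' SKETCH =1 words w (Nat.lxor Y (element_sketch w LV s rho X K)).
Proof.
move=> en Xw h8 h9 h10 hX hY.
pose Inv j st := [/\ env st, arr st ARG =1 X, at_field j st, ireg st 10 = j * (s * hash_width s) &
      arr st SKETCH =1 words w (Nat.lxor Y (element_sketch w LV s rho X j))].
have nN j s1 : Inv j s1 -> ireg s1 0 = K by case=> -[_ e] *; rewrite e.
have stab j s1 v b : Inv j s1 -> Inv j (set_wreg w (set_ireg s1 5 v) 20 b).
  move=> [[e1 e2] i1 i2 i3 i4]; split=> //.
  split=> [r r7|i i5]; rewrite /= put_neq ?e1 ?e2 //; lia.
have wr : writes_from 10 8 (update_copy s).
  by rewrite /= writes_rep //= writes_rep.
have step j s1 : j < K -> Inv j s1 -> ireg s1 5 = j ->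
    Inv j.+1 (evalc (update_copy s) s1) /\ ireg (evalc (update_copy s) s1) 5 = ireg s1 5.
  move=> jK [i1 i2 i3 i4 i5] _; split; last by rewrite (eval_ireg _ _ _ wr).
  by have [] := eval_update_copy i1 i2 Xw i3 i4 i5.
have sb : straight (update_copy s) by rewrite /= !straight_rep //= straight_rep.
have I0 : Inv 0 (evalc (COp Add 10 5 0) st).
  split=> //; first exact: env_eval; first exact: eval_init.
  by move=> k; rewrite /= lxorC lxor0n; exact: hY.
have [st' r [_ _ _ _ h]] := @for_loop_runs w rho Inv 20 5 0 _ K _ _ w0 isT sb nN stab step (leqnn _) I0.
exists st' => //.
have := runs_seq (@straight_runs w rho (COp Add 10 5 0) st isT) r.
by case=> t e le; exists t => //; apply: leq_trans le _; rewrite /=; lia.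
Qed.

Lemma eval_query_field Y i st : env st -> at_field i st -> arr st SKETCH =1 words w Y ->
  wreg st 9 < 2 ^ LV ->
  let st' := evalc query_field st in
  [/\ env st', at_field i.+1 st', arr st' SKETCH =1 words w Y,
      wreg st' 9 = Nat.lor (wreg st 9) (field w LV Y i) &
      (forall r, r < 9 -> wreg st' r = wreg st r) /\ (forall i, i < 8 -> ireg st' i = ireg st i)].
Proof.
move=> en hat hY V9.
pose st2 := evalc (block_of [:: CLoad 16 SKETCH 9; COp Div 16 16 10; COp Mod 16 16 4; COp Or 9 9 16]) st.
have en2 : env st2 by apply: env_eval.
have at2 : at_field i st2 by [].
have wr : writes_from 10 8 advance by [].
rewrite -[evalc query_field st]/(evalc advance st2); lazy zeta.
split.
- exact: env_eval.
- exact: (eval_advance rho LV0 LVw en2 at2).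
- by move=> k; rewrite (@eval_arr w rho SKETCH advance) // hY.
- rewrite (@eval_wreg w rho 10 8 advance) // field_words // -/f.
  case: hat => a1 a2 a3; rewrite /st2 /= /put /= a1 a3 hY (proj1 en 4) //= /eval_binop -/f.
  set x := words _ _ _; set d := 2 ^ (LV * _).
  have xw : x < 2 ^ w by exact: words_lt.
  have xd : x %/ d < 2 ^ w by apply: leq_ltn_trans xw; exact: leq_div.
  rewrite !(modn_small xw) !(modn_small xd).
  have xL : (x %/ d) %% 2 ^ LV < 2 ^ LV by rewrite ltn_pmod ?expn_gt0.
  by rewrite !(modn_small (LV_lt_pow xL)) !(@modn_small _ (2 ^ w)) // LV_lt_pow // lor_lt.
split=> [r r9|j j8].
  by rewrite (@eval_wreg w rho 10 8 advance) //= ?put_neq //; lia.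
by rewrite (@eval_ireg w rho 10 8 advance).
Qed.

Definition group_or (Y m g : nat) : nat := lor_upto (fun i => field w LV Y (g * m + i)) m.

Lemma eval_query_fields Y g m n st : env st -> at_field (g * m) st -> arr st SKETCH =1 words w Y ->
  wreg st 9 = 0 ->
  let st' := evalc (rep n query_field) st in
  [/\ env st', at_field (g * m + n) st', arr st' SKETCH =1 words w Y,
      wreg st' 9 = lor_upto (fun i => field w LV Y (g * m + i)) n &
      (forall r, r < 9 -> wreg st' r = wreg st r) /\ (forall i, i < 8 -> ireg st' i = ireg st i)].
Proof.
move=> en hat hY V9; elim: n => [|n [i1 i2 i3 i4 [i5 i6]]]; first by rewrite addn0.
rewrite evalS; lazy zeta.
have VL : wreg (evalc (rep n query_field) st) 9 < 2 ^ LV.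
  by rewrite i4; apply: lor_upto_lt => k; exact: field_lt.
have [j1 j2 j3 j4 [j5 j6]] := eval_query_field i1 i2 i3 VL.
split=> //; rewrite ?addnS //; first by rewrite j4 i4.
by split=> [r r9|i i8]; rewrite ?j5 ?j6 ?i5 ?i6.
Qed.

Definition tally_of (st : state) : tally2 :=
  Tally2 (wreg st 7) (wreg st 8) (ireg st 6) (ireg st 7).

Lemma eval_vote st : env st -> wreg st 11 < 2 ^ w ->
  tally_of (evalc vote_cmd st) = vote (tally_of st) (wreg st 11).
Proof.
move=> [ew ei] yw; rewrite /tally_of /vote.
have z : ireg st 4 = 0 by rewrite ei.
have z0 : wreg st 0 = 0 by rewrite ew.
have w1 : 1 %% 2 ^ w = 1 by rewrite modn_small // -(expn0 2) ltn_exp2l.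
rewrite /vote_cmd /= /put /= /eval_binop !modn_mod !bool_mod z !lt0n.
case: eqP => /= _; first by [].
case: eqP => /= _; first by [].
case: eqP => /= _; first by rewrite /put /= z0 addn0 !modn_mod modn_small.
case: eqP => /= _; last by [].
by rewrite /put /= z0 addn0 !modn_mod modn_small.
Qed.

Definition ballot (Y m g : nat) : nat := lowbit w (group_or Y m g).

Lemma group_or_lt Y m g : group_or Y m g < 2 ^ LV.
Proof. by apply: lor_upto_lt => k; exact: field_lt. Qed.

Lemma eval_group Y g m st : env st -> at_field (g * m) st -> arr st SKETCH =1 words w Y ->
  let st' := evalc (group_cmd m) st in
  [/\ env st', at_field (g.+1 * m) st', arr st' SKETCH =1 words w Y,
      tally_of st' = vote (tally_of st) (ballot Y m g) & ireg st' 5 = ireg st 5].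
Proof.
move=> en hat hY.
pose st0 := evalc (CSet 9 0) st.
have en0 : env st0 by apply: env_eval.
have at0 : at_field (g * m) st0 by [].
have V0 : wreg st0 9 = 0 by rewrite /st0 /= /put /= mod0n.
have [i1 i2 i3 i4 [i5 i6]] := eval_query_fields m en0 at0 hY V0.
set st1 := evalc (rep m query_field) st0 in i1 i2 i3 i4 i5 i6.
pose st2 := evalc (lowbit_cmd 9 11) st1.
have en2 : env st2 by apply: env_eval.
have y2 : wreg st2 11 = ballot Y m g.
  rewrite /st2 /= /put /= /eval_binop i4 (proj1 i1 0) //= add0n -/(group_or Y m g) !modn_mod.
  by rewrite -/(lowbit w (group_or Y m g)) modn_small //; apply/land_lt/LV_lt_pow/group_or_lt.
have yw : wreg st2 11 < 2 ^ w.
  by rewrite y2; apply/land_lt/LV_lt_pow/group_or_lt.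
have vw : writes_from 7 5 vote_cmd by [].
have vi : writes_from 7 6 vote_cmd by [].
rewrite -[evalc (group_cmd m) st]/(evalc vote_cmd st2); lazy zeta.
have v10 : wreg (evalc vote_cmd st2) 10 = wreg st2 10.
  by rewrite /vote_cmd [in LHS]/=; do 4?[case: ifP => _ //=].
have v89 : (ireg (evalc vote_cmd st2) 8 = ireg st2 8) * (ireg (evalc vote_cmd st2) 9 = ireg st2 9).
  by rewrite /vote_cmd /=; do 4?[case: ifP => _ //=].
split.
- exact: env_eval.
- case: i2 => a1 a2 a3; split; rewrite ?v10 ?v89 mulSn addnC //.
- by move=> k; rewrite (@eval_arr w rho SKETCH vote_cmd) // -[LHS]/(arr st1 SKETCH k).
- rewrite eval_vote // y2 /tally_of; congr (vote (Tally2 _ _ _ _) _).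
  + exact: i5.
  + exact: i5.
  + exact: i6.
  + exact: i6.
- by rewrite (@eval_ireg w rho _ _ _ _ 5 vi) // -[LHS]/(ireg st1 5) i6.
Qed.

Definition pow2_or0 (z : nat) : Prop := z = 0 \/ exists2 t, t < w & z = 2 ^ t.

Lemma ballot_pow2 Y m g : pow2_or0 (ballot Y m g).
Proof.
have h := group_or_lt Y m g; rewrite /ballot.
case: (posnP (group_or Y m g)) => [->|v0]; first by left; rewrite lowbit0.
right; have [t vt] := level_ex v0; have vw := LV_lt_pow h; exists t.
  rewrite ltnNge; apply/negP => wt; move: vt; rewrite /level_is modn_small; last first.
    by apply: leq_trans vw _; rewrite leq_exp2l //; lia.
  by move/eqP=> E; move: vw; rewrite E ltn_exp2l //; lia.
exact: lowbit_lev vw (eqP vt).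
Qed.

(** A candidate is 0 or one of the ballots. Taken with [pow2_or0], this makes the quotient that is
    finally powered 0 or a power of two. *)
Lemma election_cand (P : nat -> Prop) (b : nat -> nat) n : P 0 -> (forall k, P (b k)) ->
  P (cand1 (election b n)) /\ P (cand2 (election b n)).
Proof.
move=> P0 Pb; elim: n => //= n; case: (election b n) => c1 c2 n1 n2 /= [h1 h2].
by do 4?[case: ifP => _ //=].
Qed.

(** The estimate may exceed a word, but as [z] is 0 or a power of two, every power of it has at most
    one nonzero word, tracked as a value and an offset. *)
Lemma eval_power_step z k st : env st -> wreg st 12 = z -> pow2_or0 z ->
  wreg st 13 < 2 ^ w -> wreg st 13 * 2 ^ (w * ireg st 9) = z ^ k ->
  let st' := evalc power_step st in
  [/\ env st', wreg st' 12 = z, wreg st' 13 < 2 ^ w,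
      wreg st' 13 * 2 ^ (w * ireg st' 9) = z ^ k.+1 & arr st' OUT = arr st OUT].
Proof.
move=> en h12 hz v13 hv; lazy zeta.
have en' : env (evalc power_step st) by apply: env_eval.
have M0 : 0 < 2 ^ w by rewrite expn_gt0.
have z0 : wreg st 0 = 0 by rewrite (proj1 en).
split=> //; try by rewrite /=; case: ifP.
- by rewrite /=; case: ifP => _; rewrite /= /put /= ltn_pmod.
rewrite /= /put /= /eval_binop h12 z0 !addn0 !modn_mod.
set v := wreg st 13 in v13 hv *.
have zw : z < 2 ^ w by case: hz => [->|[t tw ->]]; [rewrite expn_gt0|exact: pow_lt].
have hi : v * z %/ 2 ^ w < 2 ^ w.
  by rewrite ltn_divLR // ltn_mul.
rewrite (modn_small hi); case: eqP => [h0|/eqP h0] /=; rewrite /put /= ?modn_mod.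
  have lo : v * z < 2 ^ w by rewrite ltnNge -divn_gt0 // h0.
  by rewrite modn_small // expnSr -hv mulnAC.
(* Here the high word is nonzero: [v * z] is a power of two that is at least [2 ^ w], so its low
   word vanishes and nothing is lost by moving on to the next word. *)
have lo : (v * z) %% 2 ^ w = 0.
  case: hz => [z0'|[t tw zE]]; first by rewrite z0' muln0 mod0n.
  have [e _ vE] : exists2 e, e <= k * t & v = 2 ^ e.
    apply/dvdn_pfactor => //; apply: (@dvdn_trans (z ^ k)).
      by rewrite -hv dvdn_mulr.
    by rewrite zE -expnM mulnC.
  apply/eqP; rewrite -/(dvdn _ _) vE zE -expnD dvdn_exp2l //.
  move: h0; rewrite vE zE -expnD -lt0n divn_gt0 // leq_exp2l //.
rewrite (modn_small hi) expnSr -hv mulnAC mulnS expnD.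
by rewrite {2}(divn_eq (v * z) (2 ^ w)) lo addn0 mulnA.
Qed.

Definition query_val (s m Y : nat) : nat :=
  (2 ^ LV.-1 %/ winner (election (ballot Y m) G)) ^ s.

Lemma eval_output Y m st : env st -> tally_of st = election (ballot Y m) G ->
  (forall k, arr st OUT k = 0) ->
  arr (evalc (output_cmd s) st) OUT =1 words w (query_val s m Y).
Proof.
move=> en tE out0.
have z0 : wreg st 0 = 0 by rewrite (proj1 en).
have z5 : wreg st 5 = 1 by rewrite (proj1 en).
have z2 : wreg st 2 = 2 ^ LV.-1 by rewrite (proj1 en).
have [p1 p2] := election_cand G (or_introl erefl : pow2_or0 0) (ballot_pow2 Y m).
have Pw x : pow2_or0 x -> x < 2 ^ w.
  by case=> [->|[t tw ->]]; [rewrite expn_gt0|exact: pow_lt].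
pose st1 := evalc (block_of [:: CILt 16 6 7; CIf 16 (COp Add 11 8 0) (COp Add 11 7 0); COp Div 12 2 11;
      COp Add 13 5 0; CISet 9 0]) st.
have en1 : env st1 by apply: env_eval.
pose y := winner (election (ballot Y m) G).
have py : pow2_or0 y by rewrite /y /winner; case: ifP.
pose z := 2 ^ LV.-1 %/ y.
have pz : pow2_or0 z.
  rewrite /z; case: py => [->|[t tw ->]]; first by left; rewrite divn0.
  case: (leqP t LV.-1) => h; last by left; rewrite divn_small // ltn_exp2l.
  right; exists (LV.-1 - t); first by lia.
  by rewrite expnB.
have M1 : 1 < 2 ^ w by rewrite -(expn0 2) ltn_exp2l.
have r12 : wreg st1 12 = z.
  rewrite /z /y -tE /winner /= /put /= /eval_binop bool_mod.
  rewrite -tE /= in p1 p2.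
  case: ltnP => _ /=; rewrite /put /= z0 z2 addn0 !modn_mod.
    by rewrite (modn_small (Pw _ p2)) modn_small // (leq_ltn_trans (leq_div _ _)) // pow_lt //; lia.
  by rewrite (modn_small (Pw _ p1)) modn_small // (leq_ltn_trans (leq_div _ _)) // pow_lt //; lia.
have r13 : wreg st1 13 = 1.
  rewrite /st1 /= /put /= /eval_binop bool_mod.
  by case: ltnP => _ /=; rewrite /put /= z5 z0 addn0 !modn_mod modn_small.
have r9 : ireg st1 9 = 0 by [].
have out1 : arr st1 OUT = arr st OUT by rewrite (@eval_arr w rho OUT).
have H n : let st' := evalc (rep n power_step) st1 in
   [/\ env st', wreg st' 12 = z, wreg st' 13 < 2 ^ w,
      wreg st' 13 * 2 ^ (w * ireg st' 9) = z ^ n & arr st' OUT = arr st OUT].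
  elim: n => [|n IH].
    have base : wreg st1 13 * 2 ^ (w * ireg st1 9) = z ^ 0 by rewrite r13 r9 muln0.
    by split=> //; rewrite [wreg _ _]r13.
  rewrite evalS; lazy zeta; case: IH => i1 i2 i3 i4 i5.
  by have [j1 j2 j3 j4 j5] := eval_power_step i1 i2 pz i3 i4; rewrite j5.
have [i1 i2 i3 i4 i5] := H s.
set st2 := evalc (rep s power_step) st1 in i1 i2 i3 i4 i5.
rewrite -[evalc (output_cmd s) st]/(evalc (CStore OUT 9 13) st2) => k.
rewrite /query_val -/y -/z -i4 words_shift //= /put /= i5.
by case: eqP => _; rewrite ?out0.
Qed.

Lemma query_big_runs Y m st : env st -> arr st SKETCH =1 words w Y ->
  (forall k, arr st OUT k = 0) ->
  ireg st 8 = 0 -> ireg st 9 = 0 -> tally_of st = Tally2 0 0 0 0 ->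
  exists2 st', runs w rho (query_big s m) st
     (G * (cost (group_cmd m) + 3) + 4 + cost (output_cmd s)) st' &
    arr st' OUT =1 words w (query_val s m Y).
Proof.
move=> en hY hO h8 h9 tl0.
pose Inv j st := [/\ env st, arr st SKETCH =1 words w Y, forall k, arr st OUT k = 0,
   at_field (j * m) st & tally_of st = election (ballot Y m) j].
have nN j s1 : Inv j s1 -> ireg s1 3 = G by case=> -[_ e] *; rewrite e.
have stab j s1 v b : Inv j s1 -> Inv j (set_wreg w (set_ireg s1 5 v) 20 b).
  move=> [[e1 e2] i1 i2 i3 i4]; split=> //.
  split=> [r r7|i i5]; rewrite /= put_neq ?e1 ?e2 //; lia.
have step j s1 : j < G -> Inv j s1 -> ireg s1 5 = j ->
    Inv j.+1 (evalc (group_cmd m) s1) /\ ireg (evalc (group_cmd m) s1) 5 = ireg s1 5.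
  move=> jK [i1 i2 i3 i4 i5] _.
  have [j1 j2 j3 j4 j5] := eval_group i1 i4 i2; split=> //; split=> //.
    by move=> k; rewrite eval_arr // /= orbF stores_rep.
  by rewrite j4 i5.
have sb : straight (group_cmd m) by rewrite /= straight_rep.
have I0 : Inv 0 (evalc (COp Add 10 5 0) st).
  by split=> //; first exact: env_eval; first exact: eval_init.
have [st' r [i1 i2 i3 i4 i5]] := @for_loop_runs w rho Inv 20 5 3 _ G _ _ w0 isT sb nN stab step (leqnn _) I0.
exists (evalc (output_cmd s) st'); last exact: eval_output.
have so : straight (output_cmd s) by rewrite /= straight_rep.
have := runs_seq (@straight_runs w rho (COp Add 10 5 0) st isT) (runs_seq r (@straight_runs w rho _ st' so)).
by case=> t e le; exists t => //; apply: leq_trans le _; rewrite [cost (COp _ _ _ _)]/=; lia.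
Qed.

End Runs.

(** * Words of at most three bits *)

(* Injective when w <= 3, since every word is then a base-8 digit; the fixed
   base lets address_cmd unroll its multiplications. *)
Definition address (s : nat) (X : nat -> nat) : nat := \sum_(j < s) X j * 8 ^ j.

Fixpoint address_cmd (n : nat) : cmd :=
  if n is n'.+1 then
    CSeq (address_cmd n') (block_of [:: CISet 11 n'; CLoad 13 ARG 11; rep (8 ^ n') (CIAdd 9 13)])
  else CSkip.

(** Each element owns a whole cell of the sketch, of which only the lowest bit is toggled. *)
Definition update_small (s : nat) : cmd := block_of
  [:: address_cmd s; CLoad 16 SKETCH 9; COp Xor 16 16 5; CStore SKETCH 9 16].

Definition or_word : cmd := CSeq (CLoad 16 SKETCH 5) (COp Or 9 9 16).

(** Only emptiness of the difference is reported: its size is at most [8 ^ s], so the answer 1 is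
    within a constant factor. *)
Definition query_small : cmd :=
  CSeq (for_loop 20 5 2 or_word) (CIf 9 (CStore OUT 9 5) CSkip).

Section Small.
Variables (w s : nat) (rho : nat -> nat).
Hypotheses (w0 : 0 < w) (w3 : w <= 3).

Lemma address_lt n X : (forall k, X k < 2 ^ w) -> address n X < 8 ^ n.
Proof.
move=> Xw; rewrite /address; elim: n => [|n IH]; first by rewrite big_ord0 expn_gt0.
have X7 : X n < 8 by apply: leq_trans (Xw _) _; rewrite (_ : 8 = 2 ^ 3) // leq_exp2l.
rewrite big_ord_recr /= expnS; move: IH; set S := \sum_(j < n) _; set a := 8 ^ n; nia.
Qed.

Lemma address_inj X Y : (forall k, X k < 2 ^ w) -> (forall k, Y k < 2 ^ w) ->
  address s X = address s Y -> forall k, k < s -> X k = Y k.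
Proof.
move=> Xw Yw.
rewrite /address; elim: s => // n IH; rewrite !big_ord_recr /= => E k.
have lt := @address_lt n.
have n0 : 0 < 8 ^ n by rewrite expn_gt0.
have hn : X n = Y n.
  have := congr1 (fun t => t %/ 8 ^ n) E.
  by rewrite /= ![_ + _ * 8 ^ n]addnC !divnMDl // !divn_small ?addn0 //; exact: lt.
rewrite ltnS leq_eqVlt => /orP[/eqP -> //|]; apply: IH.
by move: E; rewrite hn => /eqP; rewrite eqn_add2r => /eqP.
Qed.

Lemma eval_address X st n : arr st ARG =1 X -> (forall k, X k < 2 ^ w) -> ireg st 9 = 0 ->
  ireg (eval w rho (address_cmd n) st) 9 = address n X.
Proof.
move=> hX Xw h9.
have ad A k : ~~ stores_to A (address_cmd k).
  by elim: k => //= k IH; rewrite negb_or IH /= stores_rep.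
elim: n => [|n IH]; first by rewrite /address big_ord0.
rewrite /address big_ord_recr -/(address n X) /=.
set st1 := set_wreg _ _ _ _.
have h13 : wreg st1 13 = X n.
  by rewrite /st1 /= /put /= (eval_arr _ _ _ (ad ARG n)) hX modn_small.
have h9' : ireg st1 9 = address n X by rewrite /st1 /= /put /= IH.
have H k : wreg (eval w rho (rep k (CIAdd 9 13)) st1) 13 = X n /\
           ireg (eval w rho (rep k (CIAdd 9 13)) st1) 9 = address n X + X n * k.
  elim: k => [|k [i1 i2]]; first by rewrite muln0 addn0.
  by rewrite evalS; split; rewrite /= /put /= ?i1 ?i2 // mulnS; lia.
by have [_ ->] := H (8 ^ n).
Qed.

Lemma update_small_runs X Y st : (forall k, X k < 2 ^ w) -> wreg st 5 = 1 ->
  ireg st 9 = 0 -> arr st ARG =1 X -> arr st SKETCH =1 words w Y ->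
  exists2 st', runs w rho (update_small s) st (cost (update_small s)) st' &
    arr st' SKETCH =1 words w (Nat.lxor Y (1 * 2 ^ (w * address s X))).
Proof.
move=> Xw h5 h9 hX hY; exists (eval w rho (update_small s) st).
  apply: straight_runs; rewrite /= andbT.
  by elim: (s) => //= n ->; rewrite straight_rep.
have ad A k : ~~ stores_to A (address_cmd k).
  by elim: k => //= k IH; rewrite negb_or IH /= stores_rep.
have wr k : writes_from 13 9 (address_cmd k).
  by elim: k => //= k ->; rewrite writes_rep.
have M1 : 1 < 2 ^ w by rewrite -(expn0 2) ltn_exp2l.
have i9 := eval_address s hX Xw h9.
move=> k; rewrite /update_small /= /put /= i9 (eval_arr _ _ _ (ad SKETCH s)).
rewrite (eval_wreg _ _ _ (wr s)) // h5 !hY /eval_binop words_lxor words_shift //.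
case: eqP => [->|_]; last by rewrite lxorC lxor0n.
by rewrite !modn_small ?lxor_lt ?words_lt.
Qed.

Lemma query_small_runs T Y st : wreg st 5 = 1 -> wreg st 9 = 0 ->
  ireg st 2 = T -> ireg st 9 = 0 -> (forall k, arr st OUT k = 0) ->
  arr st SKETCH =1 words w Y -> Y < 2 ^ (w * T) ->
  exists2 st', runs w rho query_small st (T * 5 + 6) st' &
    arr st' OUT =1 words w (Y != 0).
Proof.
move=> h5 v9 hT h9 hO hY YT.
pose Inv j st := [/\ [/\ wreg st 5 = 1, ireg st 2 = T, ireg st 9 = 0 & forall k, arr st OUT k = 0],
   arr st SKETCH =1 words w Y & wreg st 9 = lor_upto (words w Y) j].
have nN j s1 : Inv j s1 -> ireg s1 2 = T by case=> -[].
have stab j s1 v b : Inv j s1 -> Inv j (set_wreg w (set_ireg s1 5 v) 20 b) by [].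
have step j s1 : j < T -> Inv j s1 -> ireg s1 5 = j ->
    Inv j.+1 (eval w rho or_word s1) /\ ireg (eval w rho or_word s1) 5 = ireg s1 5.
  move=> jT [[i1 i2 i3 i4] i5 i6] h; split=> //; split=> //.
  rewrite /= /put /= /eval_binop h i5 i6.
  have l1 := words_lt w Y j.
  have l2 : lor_upto (words w Y) j < 2 ^ w by apply: lor_upto_lt => k; exact: words_lt.
  by rewrite !(@modn_small _ (2 ^ w)) ?lor_lt.
have I0 : Inv 0 st by [].
have [st1 r [[i1 i2 i3 i4] i5 i6]] := @for_loop_runs w rho Inv 20 5 2 or_word T 2 st w0 isT isT nN stab step isT I0.
exists (eval w rho (CIf 9 (CStore OUT 9 5) CSkip) st1).
  have := runs_seq r (@straight_runs w rho (CIf 9 (CStore OUT 9 5) CSkip) st1 isT).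
  by case=> t e le; exists t => //; apply: leq_trans le _; rewrite /=; lia.
have M1 : 1 < 2 ^ w by rewrite -(expn0 2) ltn_exp2l.
have key : (wreg st1 9 == 0) = (Y == 0).
  rewrite i6; apply/eqP/eqP => [h|->]; last first.
    by elim: (T) => //= n ->; rewrite words0.
  apply: nat_bit_eq0 => i; case: (ltnP i (w * T)) => iT; last by rewrite (bit_small YT iT).
  have := congr1 (fun v => bit v (i %% w)) h; rewrite /= bit0n bit_lor_upto => /hasPn H.
  have iw : i %/ w < T by rewrite ltn_divLR // mulnC.
  have /H : i %/ w \in iota 0 T by rewrite mem_iota.
  rewrite bit_wordsE ltn_pmod //= mulnC -divn_eq.
  by move/negbTE.
move=> k; rewrite /= key; case: eqP => _ /=; first by rewrite words0.
rewrite /put /= i1 i3; have := @words_shift w 1 0 k M1.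
by rewrite muln0 expn0 muln1 => ->; rewrite i4.
Qed.

End Small.

(** * Estimators whose sketch is an XOR over all insertions *)

Section XorEstimator.
Variables (u w R B : nat) (wp ip : seq nat).
Variables (Phi : (nat -> nat) -> 'I_u -> nat) (answer : nat -> nat).

Definition xor_sketch (a b : nat) : 'I_(2 ^ B) := Ordinal (ltn_pmod (Nat.lxor a b) (expn_gt0 2 B)).

Definition xor_estimator : estimator u w :=
  @Estimator u w R B wp ip (Ordinal (expn_gt0 2 B : 0 < 2 ^ B))
    (fun rho Y _ x => xor_sketch Y (Phi (rnd rho) x))
    (fun _ Y Y' => xor_sketch Y Y')
    (fun _ Y => answer Y).

Hypothesis Phi_lt : forall r x, Phi r x < 2 ^ B.

Lemma big_lxor_disjoint (F : 'I_u -> nat) (S1 S2 : {set 'I_u}) : [disjoint S1 & S2] ->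
  \big[Nat.lxor/0]_(x in S1 :|: S2) F x =
  Nat.lxor (\big[Nat.lxor/0]_(x in S1) F x) (\big[Nat.lxor/0]_(x in S2) F x).
Proof.
by move=> dis; rewrite -bigU //=; apply: eq_bigl => x; rewrite !inE.
Qed.

Lemma lxor_symdiff (F : 'I_u -> nat) (S1 S2 : {set 'I_u}) :
  Nat.lxor (\big[Nat.lxor/0]_(x in S1) F x) (\big[Nat.lxor/0]_(x in S2) F x) =
  \big[Nat.lxor/0]_(x in symdiff S1 S2) F x.
Proof.
rewrite (big_setID S2) /= [X in Nat.lxor _ X](big_setID S1) /= [S2 :&: S1]setIC.
set I := \big[_/_]_(x in S1 :&: S2) _; set a := \big[_/_]_(x in S1 :\: S2) _.
set b := \big[_/_]_(x in S2 :\: S1) _.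
transitivity (Nat.lxor a b).
  by apply: bit_inj => i; rewrite !bitE; do 3!case: (bit _ i).
rewrite /symdiff big_lxor_disjoint //; apply/pred0P => x /=; rewrite !inE.
by case: (x \in S1); case: (x \in S2).
Qed.

(** By [no_reinsertion] every element of a side contributes exactly once; a repeated insertion would
    cancel itself. Elements of both sides contribute twice and vanish. *)
Lemma sketch_ofE (rho : coins xor_estimator) (h : history u) : no_reinsertion h ->
  sketch_of rho h = \big[Nat.lxor/0]_(x in symdiff (maintained h false) (maintained h true))
    Phi (rnd rho) x :> nat.
Proof.
rewrite -lxor_symdiff; set F := Phi (rnd rho).
have big_lt (S : {set 'I_u}) : \big[Nat.lxor/0]_(x in S) F x < 2 ^ B.
  by apply: (big_ind (fun a => a < 2 ^ B)); [rewrite expn_gt0|move=> a b; exact: lxor_lt|move=> x _; exact: Phi_lt].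
elim: h => [|h IH i x|h1 IH1 h2 IH2] /=.
- by rewrite !big_set0.
- case/andP=> /IH {}IH xh; rewrite IH modn_small; last by rewrite !lxor_lt.
  case: i xh => xh; rewrite /= big_setU1 //=; apply: bit_inj => i; rewrite !bitE;
    by do 3!case: (bit _ i).
case/and3P=> /IH1 {}IH1 /IH2 {}IH2 /forallP dis.
rewrite IH1 IH2 modn_small; last by rewrite !lxor_lt.
rewrite !big_lxor_disjoint; try exact: dis.
by apply: bit_inj => i; rewrite !bitE; do 4!case: (bit _ i).
Qed.

End XorEstimator.

(** * The estimators *)

Lemma within_factorW K K' d e : K <= K' -> within_factor K d e -> within_factor K' d e.
Proof.
move=> KK /andP[h1 h2]; apply/andP; split.
  by apply: leq_trans h1 _; rewrite leq_mul2r KK orbT.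
by apply: leq_trans h2 _; rewrite leq_mul2r KK orbT.
Qed.

Lemma runs_computes (R : realType) u w (E : estimator u w) (rho : coins E) p m A y (T N : nat) s' :
  runs w (rnd rho) p (start E m) T s' -> arr s' A =1 words w y -> T <= N ->
  computes rho p m A y (N%:R : R)%R.
Proof.
move=> [t e le] h TN; exists t, s'; split=> //.
by rewrite Num.Theory.ler_nat (leq_trans le).
Qed.

Section Programs.
Variable s : nat.

Definition copies : nat := 7 * (4 * 2 ^ s).

(** The program may not depend on [w], so the precomputed word register 6 (1 for long words, 0 for
    short ones) selects the regime at run time. *)
Definition update_prog : cmd := CIf 6 (update_big s) (update_small s).
Definition query_prog : cmd := CIf 6 (query_big s copies) query_small.

(** One crude constant depending on [s] alone, large enough for sketch size, random words and all
    running times in both regimes. *)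
Definition time_const : nat :=
  copies * (cost (update_copy s) + 3) + cost (update_small s) + 8 * copies +
  cost (group_cmd copies) + cost (output_cmd s) + 8 ^ s * 7 + copies * (s * hash_width s) + 100.

End Programs.

Section Big.
Variables (R : realType) (s u n w G : nat).
Notation m := (copies s).
Notation LV := (trunc_log (2 ^ s) (4 * n)).+1.
Hypotheses (s12 : 12 <= s) (us : u <= 2 ^ (w * s)) (LVw : LV.*2 <= w) (G0 : 0 < G).

Let LV0 : 0 < LV. Proof. by []. Qed.
Let s0 : 0 < s. Proof. by lia. Qed.
Notation K := (G * m).
Notation T := (K %/ (w %/ LV)).+1.

Definition big_sketch (r : nat -> nat) (x : 'I_u) : nat := element_sketch w LV s r (words w x) K.

Definition big_estimator : estimator u w :=
  xor_estimator w (G * (m * (s * hash_width s))) (pos w LV K) (wpar w LV) (ipar w LV K T G)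
    big_sketch (query_val w LV G s m).

Lemma big_sketch_lt r x : big_sketch r x < 2 ^ pos w LV K.
Proof. exact: element_sketch_lt. Qed.

Lemma big_env mem : env w LV K T G (start big_estimator mem).
Proof.
have M1 : 1 < 2 ^ w by rewrite -(expn0 2) ltn_exp2l //; lia.
have hp k : k < w -> 2 ^ k < 2 ^ w by exact: pow_lt.
have h1 : 2 ^ (w - LV) < 2 ^ w by apply: hp; lia.
have h2 : 2 ^ LV.-1 < 2 ^ w by apply: hp; lia.
have h3 : 2 ^ LV < 2 ^ w by apply: hp; lia.
have h4 : 2 ^ LV - 1 < 2 ^ w by lia.
split=> // r r7.
by do 7!(case: r r7 => [|r] r7; first by rewrite /= modn_small //; lia).
Qed.

Lemma pos_le_words : pos w LV K <= w * T.
Proof.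
have := field_fits LV0 LVw K; rewrite /pos mulnS; lia.
Qed.

Lemma words_count_le : T <= m.+1 * G.
Proof.
have f1 := f_gt1 LV0 LVw; have := leq_div K (w %/ LV); lia.
Qed.

Lemma big_update_time : update_time n big_estimator (update_prog s) ((time_const s * G)%:R : R)%R.
Proof.
move=> rho h i x _; set mem := put _ _ _.
have en := big_env mem.
have [st' r hs] := @update_big_runs w LV s K T G (rnd rho) LV0 LVw s0 (words w x)
  (sketch_of rho h) _ en (fun k => words_lt w x k) erefl erefl erefl (frefl _) (frefl _).
apply: (@runs_computes R u w big_estimator rho _ _ _ _ (K * (cost (update_copy s) + 3) + 5) _ st').
- by rewrite addnS; apply: runs_if; rewrite (proj1 en).
- move=> k; rewrite hs /= modn_small // lxor_lt //; exact: big_sketch_lt.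
- rewrite /time_const; move: (cost (update_copy s)) (cost (update_small s)) (cost (group_cmd m)) (cost (output_cmd s)) => c1 c2 c3 c4; nia.
Qed.

Lemma big_merge_time : merge_time n big_estimator merge_cmd ((time_const s * G)%:R : R)%R.
Proof.
move=> rho h1 h2 _; set mem := put _ _ _.
have lt (Y : sketch big_estimator) : Y < 2 ^ (w * T).
  by apply: leq_trans (ltn_ord Y) _; rewrite leq_exp2l // pos_le_words.
have w0 : 0 < w by lia.
have [st' r hs] := @merge_runs w (rnd rho) T (sketch_of rho h1) (sketch_of rho h2)
  (start big_estimator mem) w0 erefl (lt _) (lt _) (frefl _) (frefl _).
apply: (@runs_computes R u w big_estimator rho _ _ _ _ _ _ st' r).
- by move=> k; rewrite hs /= modn_small // lxor_lt // ltn_ord.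
- have := words_count_le; rewrite /time_const.
  move: (cost (update_copy s)) (cost (update_small s)) (cost (group_cmd m)) (cost (output_cmd s)) T => c1 c2 c3 c4 t; nia.
Qed.

Lemma big_query_time : query_time n big_estimator (query_prog s) ((time_const s * G)%:R : R)%R.
Proof.
move=> rho h _; set mem := put _ _ _.
have en := big_env mem.
have tl0 : tally_of (start big_estimator mem) = Tally2 0 0 0 0 by rewrite /tally_of /= mod0n.
have [st' r hs] := @query_big_runs w LV s K T G (rnd rho) LV0 LVw s0
  (sketch_of rho h) m _ en (frefl _) (fun=> erefl) erefl erefl tl0.
apply: (@runs_computes R u w big_estimator rho _ _ _ _ (G * (cost (group_cmd m) + 3) + 4 + cost (output_cmd s)).+1 _ st').
- by apply: runs_if; rewrite (proj1 en).
- exact: hs.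
- rewrite /time_const; move: (cost (update_copy s)) (cost (update_small s)) (cost (group_cmd m)) (cost (output_cmd s)) => c1 c2 c3 c4; nia.
Qed.

Lemma big_sketch_bits : sketch_bits big_estimator <= time_const s * G * LV.
Proof.
rewrite /= /pos; set f := w %/ LV; set L := LV.
have f1 := f_gt1 LV0 LVw; rewrite -/f in f1.
have wf : w < f.+1 * L by rewrite /f -ltn_divLR.
have KE := divn_eq K f.
(* Since [w < (f + 1) * L <= 2 * f * L], rounding to whole fields per word at most doubles the
   space. *)
have h1 : w * (K %/ f) <= 2 * L * K.
  apply: (@leq_trans (2 * L * f * (K %/ f))); first by rewrite leq_mul2r; apply/orP; right; nia.
  by rewrite -mulnA leq_mul2l [f * _]mulnC leq_divM orbT.
have h2 : L * (K %% f) <= L * K by rewrite leq_mul2l leq_mod orbT.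
have h3 : 3 * m <= time_const s by rewrite /time_const; lia.
have h4 : w * (K %/ f) + L * (K %% f) <= 3 * m * (G * L) by lia.
by apply: leq_trans h4 _; rewrite -[X in _ <= X]mulnA leq_mul2r h3 orbT.
Qed.

Lemma big_rand_words : rand_words big_estimator <= time_const s * G.
Proof.
rewrite /= mulnC leq_mul2r /time_const; apply/orP; right; lia.
Qed.

Lemma difference_le (h : history u) : legal n h -> difference h <= 2 * n.
Proof.
case/andP=> _ /forallP hn; apply: leq_trans (leq_card_setU _ _) _.
rewrite mul2n -addnn; apply: leq_add.
  by apply: leq_trans (hn false); apply: subset_leq_card; exact: subsetDl.
by apply: leq_trans (hn true); apply: subset_leq_card; exact: subsetDl.
Qed.

Lemma big_accuracy (h : history u) : legal n h ->
  #|[set rho : coins big_estimator | ~~ within_factor (2 * 8 ^ s) (difference h) (estimate rho h)]| * 2 ^ G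
  <= #|coins big_estimator|.
Proof.
move=> hl; set Delta := symdiff (maintained h false) (maintained h true).
(* The difference has at most [2 * n] elements, so [2 * d <= 4 * n]; hence the [4 * n] in [LV]. *)
have jL : top_level s Delta < LV.
  rewrite ltnS; apply: leq_trunc_log; have := difference_le hl.
  by rewrite /difference -/Delta; lia.
have := @card_bad_majority u w LV s m Delta LV0 LVw us s12 erefl jL G.
apply: leq_trans; rewrite leq_mul2r; apply/orP; right.
apply: subset_leq_card; apply/subsetP => rho; rewrite !inE; apply: contraR => few.
have nore : no_reinsertion h by case/andP: hl.
have skE := @sketch_ofE u w _ _ _ _ _ (query_val w LV G s m) big_sketch_lt rho h nore.
set Y := sketch_of rho h in skE.
have fieldE i : i < K -> field w LV Y i = copy_sketch w LV s Delta (fun j => rnd rho (i * (s * hash_width s) + j)).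
  move=> iK; rewrite skE /copy_sketch; apply: (big_rec2 (fun a b => field w LV a i = b)).
    exact: field0.
  move=> x b a _ IH; rewrite field_lxor IH; congr Nat.lxor.
  by rewrite /big_sketch (@field_element_sketch w LV s LV0 LVw).
(* Copy [g * m + i] reads exactly the random words of block [i] inside block [g], so the fields of
   the sketch match the nested blocks of the probabilistic argument. *)
have ballotE (g : 'I_G) : ballot w LV Y m g = group_value w LV s m Delta (rnd (block rho g)).
  rewrite /ballot /group_value /group_or; congr lowbit; apply: eq_lor_upto => i im.
  rewrite fieldE; last by rewrite -ltn_divLR ?(leq_ltn_trans _ im) // divnMDl ?(leq_ltn_trans _ im) // divn_small // addn0.
  apply: (copy_sketch_ext Delta LV0 LVw) => j jb; rewrite rnd_block; last by nia.
  by congr (rnd rho _); ring.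
have gv := @good_value_estimate u w LV s m Delta LV0 LVw us s12 erefl jL.
(* The factor is weakened to the constant shared with the short-word estimator. *)
apply: (@within_factorW (2 * 2 ^ s)); first by rewrite leq_mul2l leq_exp2r //; lia.
rewrite -[estimate rho h]/(query_val w LV G s m Y) /query_val.
apply: gv; apply: (@winner_good _ _ _
  (if #|Delta| == 0 then 0 else 2 ^ (LV.-1 - top_level s Delta))
  (if #|Delta| == 0 then 0 else 2 ^ (LV.-1 - (top_level s Delta).+1))).
  move=> y; rewrite /good_value; case: (#|Delta| == 0); first by move/eqP=> ->; left.
  by case/orP=> /eqP ->; [left|right].
rewrite ltnNge; apply: contra few => few; apply: leq_trans few _.
rewrite leq_mul2l /bad_groups /=; apply/eq_leq/eq_bigr => g _.
by rewrite ballotE.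
Qed.

End Big.

Section SmallWords.
Variables (R : realType) (s u n w G : nat).
Hypotheses (us : u <= 2 ^ (w * s)) (w0 : 0 < w) (w3 : w <= 3) (G0 : 0 < G).

Definition small_sketch (r : nat -> nat) (x : 'I_u) : nat := 1 * 2 ^ (w * address s (words w x)).

Definition small_estimator : estimator u w :=
  xor_estimator w 0 (w * 8 ^ s) [:: 0; 0; 0; 0; 0; 1; 0] [:: 0; 0; 8 ^ s; 0; 0]
    small_sketch (fun Y => Y != 0).

Lemma small_sketch_lt r x : small_sketch r x < 2 ^ (w * 8 ^ s).
Proof.
rewrite /small_sketch mul1n ltn_exp2l // ltn_pmul2l //.
exact: (address_lt w0 w3 s (words_lt w x)).
Qed.

Lemma mod1 : 1 %% 2 ^ w = 1.
Proof. by rewrite modn_small // -(expn0 2) ltn_exp2l. Qed.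

Lemma small_update_time : update_time n small_estimator (update_prog s) ((time_const s * G)%:R : R)%R.
Proof.
move=> rho h i x _; set mem := put _ _ _.
have [st' r hs] := @update_small_runs w s (rnd rho) w0 w3 (words w x)
  (sketch_of rho h) (start small_estimator mem) (fun k => words_lt w x k) mod1 erefl (frefl _) (frefl _).
apply: (@runs_computes R u w small_estimator rho _ _ _ _ (cost (update_small s)).+1 _ st').
- by apply: runs_if; rewrite /= mod0n.
- by move=> k; rewrite hs /= modn_small // lxor_lt //; exact: small_sketch_lt.
- rewrite /time_const; move: (cost (update_copy s)) (cost (update_small s)) (cost (group_cmd _)) (cost (output_cmd s)) => c1 c2 c3 c4; nia.
Qed.

Lemma small_merge_time : merge_time n small_estimator merge_cmd ((time_const s * G)%:R : R)%R.
Proof.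
move=> rho h1 h2 _; set mem := put _ _ _.
have [st' r hs] := @merge_runs w (rnd rho) (8 ^ s) (sketch_of rho h1) (sketch_of rho h2)
  (start small_estimator mem) w0 erefl (ltn_ord _) (ltn_ord _) (frefl _) (frefl _).
apply: (@runs_computes R u w small_estimator rho _ _ _ _ _ _ st' r).
- by move=> k; rewrite hs /= modn_small // lxor_lt // ltn_ord.
- rewrite /time_const; move: (cost (update_copy s)) (cost (update_small s)) (cost (group_cmd _)) (cost (output_cmd s)) => c1 c2 c3 c4; nia.
Qed.

Lemma small_query_time : query_time n small_estimator (query_prog s) ((time_const s * G)%:R : R)%R.
Proof.
move=> rho h _; set mem := put _ _ _.
have z9 : wreg (start small_estimator mem) 9 = 0 by rewrite /= mod0n.
have [st' r hs] := @query_small_runs w (rnd rho) w0 w3 (8 ^ s) (sketch_of rho h)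
  (start small_estimator mem) mod1 z9 erefl erefl (fun=> erefl) (frefl _) (ltn_ord _).
apply: (@runs_computes R u w small_estimator rho _ _ _ _ (8 ^ s * 5 + 7) _ st').
- by rewrite addnS; apply: runs_if; rewrite /= mod0n.
- exact: hs.
- rewrite /time_const; move: (cost (update_copy s)) (cost (update_small s)) (cost (group_cmd _)) (cost (output_cmd s)) => c1 c2 c3 c4; nia.
Qed.

Lemma small_accuracy (rho : coins small_estimator) (h : history u) : no_reinsertion h ->
  within_factor (2 * 8 ^ s) (difference h) (estimate rho h).
Proof.
move=> nore; have skE := @sketch_ofE u w _ _ _ _ _ (fun Y => Y != 0 : nat) small_sketch_lt rho h nore.
rewrite -[estimate rho h]/(nat_of_bool (nat_of_ord (sketch_of rho h) != 0)) skE /difference.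
set Delta := symdiff _ _.
have dle : #|Delta| <= 8 ^ s.
  apply: leq_trans (max_card _) _; rewrite card_ord; apply: leq_trans us _.
  by rewrite (_ : 8 = 2 ^ 3) // -expnM leq_exp2l // leq_mul2r w3 orbT.
case: (set_0Vmem Delta) => [->|[x0 x0D]]; first by rewrite cards0 big_set0.
suff -> : \big[Nat.lxor/0]_(x in Delta) small_sketch (rnd rho) x != 0.
  have : 0 < #|Delta| by apply/card_gt0P; exists x0.
  by move=> d0; apply/andP; split; nia.
apply/eqP => /(congr1 (fun v => bit v (w * address s (words w x0)))).
rewrite bit0n bit_big_lxor (bigD1 x0) //= big1 => [|x /andP[_ xx0]]; first by rewrite /small_sketch mul1n bit_pow eqxx.
rewrite /small_sketch mul1n bit_pow eqn_pmul2l //; case: eqP => // E.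
have [k ks] := words_neq w0 us xx0.
by rewrite (address_inj w0 w3 (words_lt w x0) (words_lt w x) E ks) eqxx.
Qed.

End SmallWords.

Lemma estimator_exists (R : realType) (s : nat) : 12 <= s ->
  exists (upd mrg qry : cmd) (A K : nat), forall u n w G : nat,
    0 < w -> 0 < n -> 0 < G -> u <= 2 ^ (w * s) -> n ^ 4 <= 2 ^ (w * s) ->
    exists E : estimator u w,
      [/\ sketch_bits E <= A * G * (trunc_log (2 ^ s) (4 * n)).+1,
          rand_words E <= A * G,
          [/\ update_time n E upd ((A * G)%:R : R)%R, merge_time n E mrg ((A * G)%:R : R)%R
            & query_time n E qry ((A * G)%:R : R)%R]
        & forall h, legal n h ->
          #|[set rho : coins E | ~~ within_factor K (difference h) (estimate rho h)]| * 2 ^ G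
            <= #|coins E|].
Proof.
move=> s12; exists (update_prog s), merge_cmd, (query_prog s), (time_const s), (2 * 8 ^ s).
move=> u n w G w0 n0 G0 us ns; set LV := (trunc_log _ _).+1.
case: (leqP LV.*2 w) => LVw.
  exists (big_estimator s u n w G); split.
  - exact: big_sketch_bits.
  - exact: big_rand_words.
  - split; [exact: big_update_time|exact: big_merge_time|exact: big_query_time].
  - by move=> h; exact: big_accuracy.
(* With [t = LV - 1], [2 ^ (4 * s * t) <= (4 * n) ^ 4 <= 2 ^ (8 + w * s)], so [t] is at most about
   [w / 4]. With [s >= 12] this contradicts [w < 2 * LV] unless [w <= 3]; the exponent 4 in the
   hypothesis on [n] provides the slack. *)
have w3 : w <= 3.
  have n4 : 0 < 4 * n by lia.
  have B1 : 1 < 2 ^ s by rewrite -(expn0 2) ltn_exp2l //; lia.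
  have := trunc_logP B1 n4; rewrite -expnM => h.
  have : 2 ^ (s * LV.-1 * 4) <= 2 ^ (8 + w * s).
    rewrite expnM expnD; apply: (@leq_trans ((4 * n) ^ 4)); first by rewrite leq_exp2r.
    by rewrite expnMn (_ : 4 ^ 4 = 2 ^ 8) // leq_mul2l ns orbT.
  rewrite leq_exp2l // => h2.
  by move: LVw; rewrite /LV /= in h2 *; move: (trunc_log _ _) h2 => t h2; nia.
exists (small_estimator s u w); split.
- rewrite /= /time_const.
  have : w * 8 ^ s <= 3 * 8 ^ s by rewrite leq_mul2r w3 orbT.
  by move: (cost (update_copy s)) (cost (update_small s)) (cost (group_cmd _)) (cost (output_cmd s)) (8 ^ s) => c1 c2 c3 c4 e; rewrite /LV; nia.
- by [].
- split; [exact: small_update_time|exact: small_merge_time|exact: small_query_time].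
- move=> h /andP[nore _].
  rewrite (_ : [set _ | _] = set0) ?cards0 //; apply/setP => rho.
  by rewrite !inE (small_accuracy us w0 w3 G0).
Qed.

Import Order.TTheory GRing.Theory Num.Theory.
Local Open Scope ring_scope.

(** * Passage to real logarithms and probabilities *)

Lemma ln_nat_pow (R : realType) (k : nat) : ln ((2 ^ k)%N%:R : R) = k%:R * ln 2.
Proof. by rewrite natrX lnXn // mulr_natl. Qed.

Lemma le_pow2_of_ln (R : realType) (k a : nat) : (0 < a)%N ->
  ln a%:R <= k%:R * ln 2 :> R -> (a <= 2 ^ k)%N.
Proof.
by move=> a0; rewrite -ln_nat_pow ler_ln ?posrE ?ltr0n ?expn_gt0 // ler_nat.
Qed.

Lemma ln_nat_ge0 (R : realType) (a : nat) : (0 < a)%N -> 0 <= ln (a%:R : R).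
Proof. by move=> a0; rewrite ln_ge0 // ler1n. Qed.

Lemma ln2_gt0 (R : realType) : 0 < ln (2 : R).
Proof. by rewrite ln_gt0 // ltr1n. Qed.

Lemma levels_le (R : realType) (s n : nat) : (0 < s)%N -> (0 < n)%N ->
  (trunc_log (2 ^ s) (4 * n)).+1%:R <= (3 + (ln 2)^-1) * lg1 (n%:R : R).
Proof.
move=> s0 n0; set t := trunc_log _ _; have l2 := ln2_gt0 R; have ln0 := ln_nat_ge0 R n0.
have B1 : (1 < 2 ^ s)%N by rewrite -(expn0 2) ltn_exp2l.
have n4 : (0 < 4 * n)%N by rewrite muln_gt0.
have h1 : (2 ^ t <= 4 * n)%N.
  by apply: leq_trans (trunc_logP B1 n4); rewrite -expnM leq_exp2l // leq_pmull.
have h2 : t%:R * ln 2 <= 2 * ln 2 + ln n%:R :> R.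
  rewrite -ln_nat_pow -[2 * ln 2](ln_nat_pow R 2) -lnM ?posrE ?ltr0n //.
  by rewrite ler_ln ?posrE -?natrM ?ltr0n ?expn_gt0 // ler_nat.
have h3 : t%:R <= 2 + (ln 2)^-1 * ln n%:R :> R.
  by rewrite -(ler_pM2r l2) mulrDl [_ * ln n%:R]mulrC mulfVK ?gt_eqF.
have i0 : 0 < (ln (2 : R))^-1 by rewrite invr_gt0.
rewrite -natr1 /lg1; nra.
Qed.

(** [G] is the integer part of log2 (1 / delta) plus one: rounding up makes [2 ^ -G] at most
    [delta], and the 1 in [lg1] absorbs the extra unit. *)
Lemma repetitions (R : realType) (delta : R) : 0 < delta < 1 ->
  exists G : nat, [/\ (0 < G)%N, 1 <= delta * 2 ^+ G
    & G%:R <= ((ln 2)^-1 + 1) * lg1 delta^-1].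
Proof.
case/andP=> d0 d1; have l2 := ln2_gt0 R.
have i0 : 0 < (ln (2 : R))^-1 by rewrite invr_gt0.
have ld : 0 <= ln delta^-1 by rewrite ln_ge0 // invf_ge1 // ltW.
set x := ln delta^-1 / ln 2; have x0 : 0 <= x by rewrite /x divr_ge0 // ltW.
exists (Num.trunc x).+1; split=> //.
  have : x < (Num.trunc x).+1%:R by exact: truncnS_gt.
  rewrite /x ltr_pdivrMr // -ln_nat_pow ltr_ln ?posrE ?invr_gt0 ?ltr0n ?expn_gt0 //.
  by rewrite natrX invf_plt ?posrE ?exprn_gt0 // => /ltW; rewrite -div1r ler_pdivrMr ?exprn_gt0.
have : (Num.trunc x)%:R <= x by rewrite truncn_le.
by rewrite -natr1 /lg1 /x; nra.
Qed.

Lemma Pr_ge (R : realType) (T : finType) (B : pred T) (G : nat) (delta : R) :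
  (0 < #|T|)%N -> (#|[set x | ~~ B x]| * 2 ^ G <= #|T|)%N -> 1 <= delta * 2 ^+ G ->
  1 - delta <= Pr R B.
Proof.
move=> T0 bad dG; have T0' : 0 < #|T|%:R :> R by rewrite ltr0n.
rewrite /Pr ler_pdivlMr // mulrBl mul1r lerBlDr.
have cardE : #|T|%:R = #|[set x | B x]|%:R + #|[set x | ~~ B x]|%:R :> R.
  rewrite -natrD -(cardsC [set x | B x]); congr ((_ + #|pred_of_set _|)%:R).
  by apply/setP => x; rewrite !inE.
rewrite {1}cardE lerD2l; set b := #|[set x | ~~ B x]|%:R.
have p0 : 0 < 2 ^+ G :> R by rewrite exprn_gt0.
have bG : b * 2 ^+ G <= #|T|%:R by rewrite /b -natrX -natrM ler_nat.
have d0 : 0 <= delta by rewrite -(pmulr_lge0 _ p0); apply: le_trans dG.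
rewrite -(ler_pM2r p0); apply: le_trans bG _.
by rewrite mulrAC ler_peMl // ltW.
Qed.

Lemma computesW (R : realType) u w (E : estimator u w) (rho : coins E) p m A y (T T' : R) :
  T <= T' -> computes rho p m A y T -> computes rho p m A y T'.
Proof. by move=> TT [t [s' [e h le]]]; exists t, s'; split=> //; apply: le_trans le TT. Qed.

Unset Implicit Arguments.

Theorem theorem4 (R : realType) (c : R) :
  0 < c ->
  exists (upd mrg qry : cmd) (C : R) (K : nat),
    forall (u n w : nat) (delta : R),
      (0 < u)%N -> (0 < n)%N -> (0 < w)%N ->
      c * (ln u%:R + ln n%:R) <= w%:R ->
      0 < delta < 1 ->
      exists E : estimator u w,
        [/\ (sketch_bits E)%:R <= C * lg1 delta^-1 * lg1 n%:R,
            (rand_words E)%:R <= C * lg1 delta^-1 * lg1 n%:R,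
            [/\ update_time n E upd (C * lg1 delta^-1),
                merge_time n E mrg (C * lg1 delta^-1)
              & query_time n E qry (C * lg1 delta^-1)]
          & accurate n E K delta].
Proof.
move=> c0; have l2 := ln2_gt0 R.
have i0 : 0 < (ln (2 : R))^-1 by rewrite invr_gt0.
(* The second summand gives [c * ln 2 * s >= 4], so the bound on [w] makes both [4 * ln u] and
   [4 * ln n] at most [w * s * ln 2]; the 12 is what the failure bound of a group requires. *)
pose s := (12 + (Num.trunc (4 / (c * ln 2))).+1)%N.
have s12 : (12 <= s)%N by exact: leq_addr.
have cs : 4 <= c * ln 2 * s%:R.
  have cl : 0 < c * ln 2 by rewrite mulr_gt0.
  rewrite mulrC -ler_pdivrMr //; apply: ltW; apply: lt_le_trans (truncnS_gt _) _.
  by rewrite ler_nat leq_addl.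
have [upd [mrg [qry [A [K main]]]]] := estimator_exists R s12.
pose a : R := (ln 2)^-1 + 1; pose b : R := 3 + (ln 2)^-1.
exists upd, mrg, qry, (A%:R * a * b), K => u n w delta u0 n0 w0 hw hd.
have lu := ln_nat_ge0 R u0; have ln_ := ln_nat_ge0 R n0.
have key x : 0 <= x -> c * x <= w%:R -> 4 * x <= (w * s)%:R * ln 2.
  move=> x0 cx; rewrite natrM; apply: (@le_trans _ _ (c * ln 2 * s%:R * x)).
    by rewrite ler_wpM2r.
  have -> : c * ln 2 * s%:R * x = c * x * (s%:R * ln 2) by ring.
  by rewrite -[w%:R * _ * _]mulrA ler_wpM2r // mulr_ge0 // ltW.
have us : (u <= 2 ^ (w * s))%N.
  apply: (@le_pow2_of_ln R) => //; apply: (@le_trans _ _ (4 * ln u%:R)); first by nra.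
  by apply: key => //; apply: le_trans hw; rewrite ler_pM2l // lerDl.
have ns : (n ^ 4 <= 2 ^ (w * s))%N.
  apply: (@le_pow2_of_ln R); first by rewrite expn_gt0 n0.
  rewrite natrX lnXn ?ltr0n // -[ln _ *+ 4]mulr_natl; apply: key => //.
  by apply: le_trans hw; rewrite ler_pM2l // lerDr.
have [G [G0 dG GE]] := repetitions hd.
have [E [hbits hrand [hu hm hq] hacc]] := main u n w G w0 n0 G0 us ns.
have s0 : (0 < s)%N by [].
have LVE := levels_le R s0 n0.
have ld1 : 1 <= lg1 delta^-1.
  by case/andP: hd => d0 d1; rewrite /lg1 lerDl ln_ge0 // invf_ge1 // ltW.
have ln1 : 1 <= lg1 (n%:R : R) by rewrite /lg1 lerDl.
have A0 : 0 <= A%:R :> R by [].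
have AG : (A * G)%:R <= A%:R * a * lg1 delta^-1 by rewrite natrM -mulrA ler_wpM2l.
have P0 : 0 <= A%:R * a * lg1 delta^-1 by apply: le_trans AG.
have b1 : 1 <= b by rewrite /b; lra.
have AGb : (A * G)%:R <= A%:R * a * b * lg1 delta^-1.
  apply: le_trans AG _; rewrite [A%:R * a * b * _]mulrAC ler_peMr //.
exists E; split.
- apply: (@le_trans _ _ (A * G * (trunc_log (2 ^ s) (4 * n)).+1)%:R); first by rewrite ler_nat.
  rewrite natrM; apply: le_trans (ler_pM _ _ AG LVE) _ => //.
  by rewrite -/b le_eqVlt; apply/orP; left; apply/eqP; ring.
- apply: (@le_trans _ _ (A * G)%:R); first by rewrite ler_nat.
  by apply: (le_trans AGb); rewrite ler_peMr // (le_trans _ AGb).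
- split.
  + by move=> rho h i x hl; apply: (computesW AGb); exact: hu.
  + by move=> rho h1 h2 hl; apply: (computesW AGb); exact: hm.
  + by move=> rho h hl; apply: (computesW AGb); exact: hq.
move=> h hl; apply: Pr_ge dG; last exact: hacc.
by rewrite card_tuple card_ord expn_gt0 expn_gt0.
Qed.
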